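(* Let $n\ge 1$ and let $k\ge 0$ be an integer. Let $f_1$ and $f_2$ be two centered stationary Gaussian fields on $\mathbb{R}^n$ with spectral densities $\rho_1$ and $\rho_2$ respectively (with respect to Lebesgue measure $dt$ on $\mathbb{R}^n$). Assume that both spectral measures $\rho_1(t)\,dt$ and $\rho_2(t)\,dt$ have finite moments of order up to $2(k+1)$. Then there is a coupling of $f_1$ and $f_2$ (i.e. a realization of both fields on one probability space) such that $F=f_2-f_1$ is a centered stationary Gaussian field and the quantity \[ \sigma^2=\sup_{x\in\mathbb{R}^n}\max_{|\alpha|\le k+1}\mathbb{E}\left(\partial^\alpha F(x)\right)^2=\max_{|\alpha|\le k+1}\mathbb{E}\left(\partial^\alpha F(0)\right)^2 \] is given by \[ \sigma^2=\sup_{|\alpha|\le k+1}(2\pi)^{2|\alpha|}\left\|t^\alpha\left(\sqrt{\rho_2(t)}-\sqrt{\rho_1(t)}\right)\right\|_{L^2(\mathbb{R}^n,dt)}^2 . \]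
   Context: A real centered stationary Gaussian field $f$ on $\mathbb{R}^n$ has covariance kernel $K(x)=\mathbb{E}[f(y)f(y+x)]$ (independent of $y$). Its spectral measure is the finite positive symmetric (i.e. invariant under $t\mapsto -t$) measure $\rho$ on $\mathbb{R}^n$ with $K(x)=\int_{\mathbb{R}^n}e^{2\pi i x\cdot t}\,d\rho(t)$. The field has spectral density $\rho(t)$ if $d\rho(t)=\rho(t)\,dt$ with $\rho(t)\ge 0$ an even integrable function. Here $\alpha$ denotes a multi-index, $t^\alpha=\prod_i t_i^{\alpha_i}$. For a centered Gaussian field $F$ with covariance kernel $K_F(x,y)=\mathbb{E}F(x)F(y)$, the quantity $\mathbb{E}(\partial^\alpha F(x))^2$ means $\partial_x^\alpha\partial_y^\alpha K_F(x,y)|_{y=x}$ (equivalently, derivatives are understood in the mean-square sense). *)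

(* Defs.v *)
From HB Require Import structures.
From mathcomp Require Import all_boot all_order all_algebra.
From mathcomp Require Import all_classical all_reals all_analysis.
From mathcomp Require Import measurable_realfun.
From mathcomp.real_closed Require Import complex.

Set Implicit Arguments.
Unset Strict Implicit.
Unset Printing Implicit Defensive.

Import Order.TTheory GRing.Theory Num.Theory.
Import numFieldNormedType.Exports.

Local Open Scope classical_set_scope.
Local Open Scope ring_scope.

(* R^n is 'rV[R]_n, with the sigma-algebra generated by the coordinates (this
   is the Borel sigma-algebra). *)
Definition rV_display : measure_display -> measure_display.
Proof. exact. Qed.

Section measurable_rV.
Context {R : realType} {n : nat}.

Let coors : 'I_n -> 'rV[R]_n -> R := fun i x => x ord0 i.

Let rV_set0 : g_sigma_preimage coors set0.
Proof. exact: sigma_algebra0. Qed.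

Let rV_setC A : g_sigma_preimage coors A -> g_sigma_preimage coors (~` A).
Proof. exact: sigma_algebraC. Qed.

Let rV_bigcup (F : _^nat) : (forall i, g_sigma_preimage coors (F i)) ->
  g_sigma_preimage coors (\bigcup_i (F i)).
Proof. exact: sigma_algebra_bigcup. Qed.

HB.instance Definition _ := @isMeasurable.Build (rV_display default_measure_display)
  'rV[R]_n (g_sigma_preimage coors) rV_set0 rV_setC rV_bigcup.

Lemma measurable_rV_coor (i : 'I_n) :
  measurable_fun [set: 'rV[R]_n] (fun x : 'rV[R]_n => x ord0 i).
Proof.
move=> _ Y mY; rewrite setTI; apply: sub_sigma_algebra => /=.
rewrite -bigcup_seq/=; exists i => /=; first by rewrite mem_index_enum.
by exists Y => //; rewrite setTI.
Qed.

Lemma measurable_fun_rV d (T : measurableType d) (f : T -> 'rV[R]_n) :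
  (forall i, measurable_fun [set: T] (fun w => f w ord0 i)) ->
  measurable_fun [set: T] f.
Proof.
move=> mf _ A mA; rewrite setTI.
have : g_sigma_preimage (fun i w => coors i (f w)) (f @^-1` A).
  by rewrite (g_sigma_preimage_comp coors f); exists A => //; rewrite setTI.
apply: smallest_sub; first exact: sigma_algebra_measurable.
rewrite -bigcup_seq => B [i /= _ [C mC <-]].
exact: (mf i measurableT C mC).
Qed.

End measurable_rV.

Section lebesgue_rV.
Context {R : realType}.

Definition cons_rV n (p : R * 'rV[R]_n) : 'rV[R]_n.+1 :=
  \row_i (if unlift ord0 i is Some j then p.2 ord0 j else p.1).

Definition uncons_rV n (x : 'rV[R]_n.+1) : R * 'rV[R]_n :=
  (x ord0 ord0, \row_j x ord0 (lift ord0 j)).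

Lemma cons_rVK n : cancel (@cons_rV n) (@uncons_rV n).
Proof.
move=> [a x]; rewrite /uncons_rV /cons_rV !mxE unlift_none; congr pair.
by apply/rowP => j; rewrite !mxE liftK.
Qed.

Lemma uncons_rVK n : cancel (@uncons_rV n) (@cons_rV n).
Proof.
by move=> x; apply/rowP => i; rewrite !mxE; case: unliftP => [j|] -> //; rewrite mxE.
Qed.

Lemma measurable_cons_rV n :
  measurable_fun [set: R * 'rV[R]_n] (@cons_rV n).
Proof.
apply: measurable_fun_rV => i; case: (unliftP ord0 i) => [j ->|->].
- rewrite [X in measurable_fun _ X](_ : _ = (fun x : 'rV[R]_n => x ord0 j) \o snd).
    exact: (measurableT_comp (measurable_rV_coor j)).
  by apply/funext => p /=; rewrite mxE liftK.
- rewrite [X in measurable_fun _ X](_ : _ = fst); first exact: measurable_fst.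
  by apply/funext => p; rewrite mxE unlift_none.
Qed.

Lemma measurable_uncons_rV n :
  measurable_fun [set: 'rV[R]_n.+1] (@uncons_rV n).
Proof.
apply: measurable_fun_pair; first exact: measurable_rV_coor.
apply: measurable_fun_rV => j.
rewrite [X in measurable_fun _ X](_ : _ = (fun x : 'rV[R]_n.+1 => x ord0 (lift ord0 j))).
  exact: measurable_rV_coor.
by apply/funext => x; rewrite mxE.
Qed.

Section step.
Context n (m : {sigma_finite_measure set 'rV[R]_n -> \bar R}).

Definition lebesgue_rV_step : set 'rV[R]_n.+1 -> \bar R :=
  pushforward (lebesgue_measure \x m)%E (@cons_rV n).


Let leb0 : lebesgue_rV_step set0 = 0%E.
Proof. by rewrite /lebesgue_rV_step /pushforward preimage_set0 measure0. Qed.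

Let leb_ge0 A : (0 <= lebesgue_rV_step A)%E.
Proof. exact: (measure_ge0 (lebesgue_measure \x m)%E). Qed.

Let mcons (A : set 'rV[R]_n.+1) : measurable A -> measurable (@cons_rV n @^-1` A).
Proof. by move=> mA; rewrite -[X in measurable X]setTI; exact: measurable_cons_rV. Qed.

Let leb_sigma_additive : semi_sigma_additive lebesgue_rV_step.
Proof.
move=> F mF tF mUF; rewrite /lebesgue_rV_step /pushforward preimage_bigcup.
apply: measure_semi_sigma_additive; first by move=> i; exact: mcons.
- apply/trivIsetP => /= i j _ _ ij; rewrite -preimage_setI.
  by move/trivIsetP : tF => /(_ _ _ _ _ ij) ->//; rewrite preimage_set0.
- by rewrite -preimage_bigcup; exact: mcons.
Qed.

HB.instance Definition _ := isMeasure.Build _ _ _ lebesgue_rV_step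
  leb0 leb_ge0 leb_sigma_additive.

Let leb_sigma_finite : sigma_finite setT lebesgue_rV_step.
Proof.
have /sigma_finiteP[F [TF ndF Foo]] := sigma_finiteT (@lebesgue_measure R).
have /sigma_finiteP[G [TG ndG Goo]] := sigma_finiteT m.
exists (fun k => @uncons_rV n @^-1` (F k `*` G k)).
  rewrite -preimage_bigcup -(preimage_setT (@uncons_rV n)); congr (_ @^-1` _).
  rewrite -setXTT TF TG predeqE => -[x y]; split.
    move=> [/= [i _ Fnx] [k _ Gky]]; exists (maxn i k) => //; split.
    - by move: x Fnx; exact/subsetPset/ndF/leq_maxl.
    - by move: y Gky; exact/subsetPset/ndG/leq_maxr.
  by move=> [i _ []/= ? ?]; split; exists i.
move=> k; have [mFk Fk] := Foo k; have [mGk Gk] := Goo k; split.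
  rewrite -[X in measurable X]setTI; apply: measurable_uncons_rV => //.
  exact: measurableX.
rewrite /lebesgue_rV_step /pushforward -comp_preimage.
rewrite (_ : _ \o _ = id); last by apply/funext => p /=; rewrite cons_rVK.
by rewrite preimage_id product_measure1E// lte_mul_pinfty// ge0_fin_numE.
Qed.

HB.instance Definition _ := Measure_isSigmaFinite.Build _ _ _ lebesgue_rV_step
  leb_sigma_finite.

End step.

Fixpoint lebesgue_rV n : {sigma_finite_measure set 'rV[R]_n -> \bar R} :=
  if n is m.+1 then lebesgue_rV_step (lebesgue_rV m) else \d_(0 : 'rV[R]_0).

Lemma lebesgue_rV_box n (A : 'I_n -> set R) : (forall i, measurable (A i)) ->
  lebesgue_rV n [set x | forall i, A i (x ord0 i)]
  = (\prod_(i < n) lebesgue_measure (A i))%E.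
Proof.
elim: n A => [|n IH] A mA /=.
  by rewrite big_ord0 diracE mem_set// => -[].
rewrite big_ord_recl -IH; last by move=> i; exact: mA.
rewrite -product_measure1E//=; last first.
- rewrite [X in measurable X](_ : _ =
      \bigcap_i [set x : 'rV[R]_n | A (lift ord0 i) (x ord0 i)]).
    apply: fin_bigcap_measurable => // i _; rewrite -[X in measurable X]setTI.
    exact: measurable_rV_coor.
  by apply/seteqP; split=> [x Ax i _|x Ax i]; exact: Ax.
- exact: mA.
rewrite /lebesgue_rV_step /pushforward; congr (_ _).
apply/seteqP; split=> [[a x] /= Ax|[a x] [/= Aa Ax] i /=].
  split=> [|i]; first by have := Ax ord0; rewrite mxE unlift_none.
  by have := Ax (lift ord0 i); rewrite mxE liftK.
by rewrite mxE; case: unliftP => [j|] ->.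
Qed.

End lebesgue_rV.

Definition dotv (R : realType) n (x t : 'rV[R]_n) : R :=
  \sum_i x ord0 i * t ord0 i.

Definition expi (R : realType) (theta : R) : R[i] := Complex (cos theta) (sin theta).

Definition Cintegral d (T : measurableType d) (R : realType)
    (mu : {measure set T -> \bar R}) (f : T -> R[i]) : R[i] :=
  Complex (\int[mu]_t complex.Re (f t)) (\int[mu]_t complex.Im (f t)).

(* Multi-indices are functions 'I_n -> nat. *)
Definition mdegree n (a : 'I_n -> nat) : nat := (\sum_i a i)%N.

Definition monomial (R : realType) n (a : 'I_n -> nat) (t : 'rV[R]_n) : R :=
  \prod_i t ord0 i ^+ a i.

(* The maximum over the multi-indices of degree at most m: their entries are
   bounded by m, so they form a finite type. *)
Definition max_mdegree (R : realType) n m (V : ('I_n -> nat) -> \bar R) : \bar R :=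
  \big[maxe/-oo%E]_(a : {ffun 'I_n -> 'I_m.+1} |
    (mdegree (fun i => a i) <= m)%N) V (fun i => a i).

Section partial_derivatives.
Context {R : realType} {n : nat}.
Implicit Types (g : 'rV[R]_n -> R) (K : 'rV[R]_n -> 'rV[R]_n -> R)
  (s : seq 'I_n) (a : 'I_n -> nat).

Definition partial (i : 'I_n) g : 'rV[R]_n -> R := 'D_(delta_mx ord0 i) g.

Definition partials s g : 'rV[R]_n -> R := foldr partial g s.

(* 'D_v is total: this says that each successive partial derivative in
   [partials s g] exists everywhere. *)
Fixpoint partials_exist s g : Prop :=
  if s is i :: s' then
    partials_exist s' g /\
    forall x, derivable (partials s' g) x (delta_mx ord0 i)
  else True.

Definition directions a : seq 'I_n :=
  flatten [seq nseq (a i) i | i <- enum 'I_n].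

(* d_x^a d_y^a K (x, y) *)
Definition mixed_partial a K (x y : 'rV[R]_n) : R :=
  partials (directions a) (fun x' => partials (directions a) (K x') y) x.

Definition mixed_partial_exists a K : Prop :=
  (forall x, partials_exist (directions a) (K x)) /\
  (forall y, partials_exist (directions a)
     (fun x => partials (directions a) (K x) y)).

End partial_derivatives.

Section fields.
Context {R : realType} {n : nat} {d : measure_display} {T : measurableType d}.
Variable P : probability T R.
Implicit Types f : 'rV[R]_n -> {RV P >-> R}.

(* Degenerate (Dirac) laws are Gaussian; they need a separate case because
   [normal_prob m 0] is a uniform law, not the Dirac measure at m. *)
Definition gaussian_rv (X : T -> R) : Prop :=
  exists m s : R, forall A : set R, measurable A ->
    pushforward P X A = if s == 0 then \d_m A else normal_prob m s A.

Definition gaussian_field f : Prop :=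
  forall m (c : 'I_m -> R) (x : 'I_m -> 'rV[R]_n),
    gaussian_rv (fun w => \sum_j c j * f (x j) w).

Definition centered f : Prop := forall x, ('E_P[f x] = 0)%E.

Definition fin_dim_law f m (x : 'I_m -> 'rV[R]_n) : set (m.-tuple R) -> \bar R :=
  pushforward P (fun w => [tuple f (x j) w | j < m]).

(* [fine] loses nothing here: Gaussian fields have finite second moments. *)
Definition covariance_kernel f (x y : 'rV[R]_n) : R :=
  fine ('E_P[f x \* f y])%E.

End fields.

Definition same_law (R : realType) n
    d1 (T1 : measurableType d1) (P1 : probability T1 R)
    d2 (T2 : measurableType d2) (P2 : probability T2 R)
    (f1 : 'rV[R]_n -> {RV P1 >-> R}) (f2 : 'rV[R]_n -> {RV P2 >-> R}) : Prop :=
  forall m (x : 'I_m -> 'rV[R]_n) (B : set (m.-tuple R)), measurable B ->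
    fin_dim_law f1 x B = fin_dim_law f2 x B.

Section stationary_fields.
Context {R : realType} {n : nat} {d : measure_display} {T : measurableType d}.
Variable P : probability T R.
Implicit Types f : 'rV[R]_n -> {RV P >-> R}.

Definition stationary f : Prop := forall h, same_law (fun x => f (x + h)) f.

Definition centered_stationary_gaussian f : Prop :=
  [/\ gaussian_field f, centered f & stationary f].

Definition spectral_density f (rho : 'rV[R]_n -> R) : Prop :=
  [/\ forall t, 0 <= rho t,
      forall t, rho (- t) = rho t,
      (lebesgue_rV n).-integrable setT (EFin \o rho)
    & forall x y, (covariance_kernel f y (y + x))%:C%C =
        Cintegral (lebesgue_rV n)
          (fun t => expi (2 * pi * dotv x t) * (rho t)%:C%C)].

(* E (d^a f (x))^2, read as the mixed derivative d_x^a d_y^a of the covariance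
   kernel on the diagonal. *)
Definition derivative_variance f (a : 'I_n -> nat) (x : 'rV[R]_n) : R :=
  mixed_partial a (covariance_kernel f) x x.

Definition sup_derivative_variance f (m : nat) : \bar R :=
  ereal_sup [set max_mdegree m (fun a => (derivative_variance f a x)%:E)
            | x in [set: 'rV[R]_n]].

End stationary_fields.

Definition finite_moments (R : realType) n (rho : 'rV[R]_n -> R) (m : nat) : Prop :=
  forall a : 'I_n -> nat, (mdegree a <= m)%N ->
    (lebesgue_rV n).-integrable setT (fun t => (monomial a t * rho t)%:E).

(* Main.v *)
(* The coupling is f_j(x) = integral of exp(2 i pi x.t) sqrt(rho_j(t)) dW(t) for
   one common white noise W, so that F has spectral density
   (sqrt rho_2 - sqrt rho_1)^2 and its derivatives are read off by
   differentiating the covariance under the integral sign. No white noise has to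
   be constructed from scratch: f_1 itself extends to a Gaussian isometry U_1 on
   the closed span of the functions exp(2 i pi x.t) sqrt(rho_1(t)), which is the
   set of all square-integrable functions that vanish where rho_1 does. With U_2
   the same isometry for f_2, on the product of the two given probability spaces
   take g_1(x) = f_1(x) and
     g_2(x) = U_1(exp(2 i pi x.t) sqrt(rho_2) 1_{rho_1 > 0})
            + U_2(exp(2 i pi x.t) sqrt(rho_2) 1_{rho_1 = 0}).
   Both the density of the span and the fact that the characteristic function
   determines the law come from the same monotone class argument: the bounded
   pointwise closure of the trigonometric polynomials contains the indicator of
   every Borel set. *)

Require Import Defs.
From HB Require Import structures.
From mathcomp Require Import all_boot all_order all_algebra.
From mathcomp Require Import all_classical all_reals all_analysis.
From mathcomp Require Import measurable_realfun.
From mathcomp Require Import ring lra.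

Set Implicit Arguments.
Unset Strict Implicit.
Unset Printing Implicit Defensive.

Import Order.TTheory GRing.Theory Num.Theory.
Import numFieldNormedType.Exports.

Import HBNNSimple.

Local Open Scope classical_set_scope.
Local Open Scope ring_scope.

(** * Square-integrable functions *)

(** Everything is carried by characteristic functions. A centered Gaussian law of variance v means E
    cos(th X) = exp(-v th^2/2) and E sin(th X) = 0: this includes v = 0, survives mean-square limits
    and independent sums, and is translated from and to [gaussian_rv] only at the two ends. A field
    is then one number per finite combination, its variance, so equality in law and stationarity
    reduce to identities between squared norms in L2(dt). The second probability space is forced:
    where rho_1 vanishes, f_1 carries no noise from which g_2 could be built. The two amplitudes of
    F, sqrt(rho_2) 1_{rho_1 > 0} - sqrt(rho_1) and sqrt(rho_2) 1_{rho_1 = 0}, have disjoint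
    supports, so their squares add up to (sqrt rho_2 - sqrt rho_1)^2. The isometries are never
    functions: [extends] is a relation, the closure of a graph, and [choice] picks one image per
    point x. Estimates use squared norms, with (a + b)^2 <= 2 (a^2 + b^2) in place of the triangle
    inequality. *)

Section real_integrals.
Context d (T : measurableType d) (R : realType) (mu : {measure set T -> \bar R}).
Implicit Types (f g h : T -> R).

Definition rintegrable f := mu.-integrable setT (EFin \o f).

Lemma rintegrable_measurable f : rintegrable f -> measurable_fun setT f.
Proof. by move=> /measurable_int /measurable_EFinP. Qed.

Lemma rintegrableD f g : rintegrable f -> rintegrable g ->
  rintegrable (fun t => f t + g t).
Proof.
move=> fi gi; rewrite /rintegrable (_ : _ \o _ = (EFin \o f) \+ (EFin \o g))%E//.
exact: integrableD.
Qed.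

Lemma rintegrableZ k f : rintegrable f -> rintegrable (fun t => k * f t).
Proof.
move=> fi; rewrite /rintegrable (_ : _ \o _ = (fun t => k%:E * (EFin \o f) t))%E//.
exact: integrableZl.
Qed.

Lemma rintegrableB f g : rintegrable f -> rintegrable g ->
  rintegrable (fun t => f t - g t).
Proof.
move=> fi gi; rewrite /rintegrable (_ : _ \o _ = (EFin \o f) \- (EFin \o g))%E//.
exact: integrableB.
Qed.

Lemma rintegrable_le f g : measurable_fun setT f -> (forall t, `|f t| <= g t) ->
  rintegrable g -> rintegrable f.
Proof.
move=> mf fg gi; apply: le_integrable gi => //; first exact/measurable_EFinP.
by move=> t _ /=; rewrite lee_fin (le_trans (fg t))// ler_norm.
Qed.

Lemma rintegrable0 : rintegrable (fun=> 0).
Proof. exact: integrable0. Qed.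

Lemma rintegrable_sum I (s : seq I) (F : I -> T -> R) :
  (forall i, rintegrable (F i)) -> rintegrable (fun t => \sum_(i <- s) F i t).
Proof.
move=> Fi; elim: s => [|i s IH].
  by under [X in rintegrable X]eq_fun do rewrite big_nil; exact: rintegrable0.
by under [X in rintegrable X]eq_fun do rewrite big_cons; exact: rintegrableD.
Qed.

Lemma Rintegral_sum I (s : seq I) (F : I -> T -> R) :
  (forall i, rintegrable (F i)) ->
  \int[mu]_t (\sum_(i <- s) F i t) = \sum_(i <- s) \int[mu]_t F i t.
Proof.
move=> Fi; elim: s => [|i s IH].
  rewrite big_nil; under eq_Rintegral do rewrite big_nil.
  by rewrite /Rintegral integral0.
rewrite big_cons; under eq_Rintegral do rewrite big_cons.
by rewrite RintegralD ?IH//; [exact: Fi|exact: rintegrable_sum].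
Qed.

Lemma EFin_Rintegral f : rintegrable f -> (\int[mu]_t f t)%:E = (\int[mu]_t (f t)%:E)%E.
Proof. by move=> fi; rewrite /Rintegral fineK//; exact: integrable_fin_num. Qed.

Lemma Rintegral_dominated_cvg (f_ : nat -> T -> R) f g :
  (forall n, measurable_fun setT (f_ n)) ->
  (forall t, f_ n t @[n --> \oo] --> f t) ->
  rintegrable g -> (forall n t, `|f_ n t| <= g t) ->
  rintegrable f /\ \int[mu]_t f_ n t @[n --> \oo] --> \int[mu]_t f t.
Proof.
move=> mf cf gi fg.
have mF : measurable_fun setT f by apply: (measurable_fun_cvg mf) => t _; exact: cf.
have cF t : setT t -> (f_ n t)%:E @[n --> \oo] --> (EFin \o f) t.
  by move=> _; apply: cvg_EFin (cf t); exact: nearW.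
have [fi _ fc] := @dominated_convergence _ _ _ mu _ measurableT
  (fun n t => (f_ n t)%:E) (EFin \o f) (EFin \o g)
  (fun n => iffRL (measurable_EFinP _ _) (mf n))
  (iffRL (measurable_EFinP _ _) mF) (aeW _ cF) gi
  (aeW _ (fun t n _ => fg n t)).
split => //; apply: fine_cvg; rewrite fineK//; exact: integrable_fin_num.
Qed.

(** The point [a] is left out because the integrands will be difference quotients; limits along its
    punctured neighbourhoods are tested on sequences. *)
Lemma Rintegral_dominated_dnbhs (F : R -> T -> R) f g (a : R) :
  (forall x, measurable_fun setT (F x)) ->
  (forall t, F x t @[x --> a^'] --> f t) ->
  rintegrable g -> (forall x t, x != a -> `|F x t| <= g t) ->
  rintegrable f /\ \int[mu]_t F x t @[x --> a^'] --> \int[mu]_t f t.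
Proof.
move=> mF cF gi Fg.
have H (u : nat -> R) : (forall n, u n != a) -> u n @[n --> \oo] --> a ->
    rintegrable f /\ \int[mu]_t F (u n) t @[n --> \oo] --> \int[mu]_t f t.
  move=> ua ca; apply: (@Rintegral_dominated_cvg (fun n => F (u n)) f g) => //.
    by move=> t; have /cvgr_dnbhsP/(_ u) := cF t; apply.
  by move=> n t; exact: Fg.
split; last by apply/cvgr_dnbhsP => u [ua ca]; have [] := H u ua ca.
(* One concrete sequence is enough for the integrability of [f]. *)
have [] := H (fun n => a + n.+1%:R^-1) => //.
  by move=> n; rewrite -subr_eq0 addrAC subrr add0r invr_eq0 pnatr_eq0.
rewrite -[X in _ --> X]addr0; apply: cvgD; [exact: cvg_cst|exact: cvg_harmonic].
Qed.

End real_integrals.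

Section square_integrable.
Context d (T : measurableType d) (R : realType) (mu : {measure set T -> \bar R}).
Implicit Types (f g h : T -> R).

Definition sqint f := measurable_fun setT f /\ rintegrable mu (fun t => f t ^+ 2).

Lemma sqintM f g : sqint f -> sqint g -> rintegrable mu (fun t => f t * g t).
Proof.
move=> [mf fi] [mg gi].
apply: (rintegrable_le _ _ (rintegrableD fi gi)); first exact: measurable_funM.
by move=> t; rewrite ler_norml; apply/andP; split; nra.
Qed.

Lemma sqint_le f g : measurable_fun setT f -> (forall t, `|f t| <= `|g t|) ->
  sqint g -> sqint f.
Proof.
move=> mf fg [mg gi]; split => //.
apply: (rintegrable_le _ _ gi); first exact: measurable_funX.
by move=> t; rewrite ger0_norm ?sqr_ge0// -real_normK ?num_real// -[leRHS]real_normK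
  ?num_real// lerXn2r ?nnegrE.
Qed.

Lemma sqintD f g : sqint f -> sqint g -> sqint (fun t => f t + g t).
Proof.
move=> [mf fi] [mg gi]; split; first exact: measurable_funD.
have := rintegrableZ 2 (rintegrableD fi gi); apply: rintegrable_le.
  by apply: measurable_funX; exact: measurable_funD.
by move=> t; rewrite ger0_norm ?sqr_ge0//; have := sqr_ge0 (f t - g t); nra.
Qed.

Lemma sqintZ k f : sqint f -> sqint (fun t => k * f t).
Proof.
move=> [mf fi]; split; first exact: measurable_funM.
by under [X in rintegrable _ X]eq_fun do rewrite exprMn; exact: rintegrableZ.
Qed.

Lemma sqintB f g : sqint f -> sqint g -> sqint (fun t => f t - g t).
Proof.
move=> sf sg; under [X in sqint X]eq_fun do rewrite -mulN1r.
by apply: sqintD => //; exact: sqintZ.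
Qed.

Lemma sqint0 : sqint (fun=> 0).
Proof.
split; first exact: measurable_cst.
by under [X in rintegrable _ X]eq_fun do rewrite expr0n; exact: rintegrable0.
Qed.

Definition sqnorm f := \int[mu]_t (f t ^+ 2).

Lemma sqnorm_ge0 f : 0 <= sqnorm f.
Proof. by apply: Rintegral_ge0 => t _; exact: sqr_ge0. Qed.

(** Stands in for the triangle inequality; the factor 2 is absorbed by smaller tolerances. *)
Lemma le_sqnormD f g : sqint f -> sqint g ->
  sqnorm (fun t => f t + g t) <= 2 * (sqnorm f + sqnorm g).
Proof.
move=> sf sg; have [_ fi] := sf; have [_ gi] := sg.
rewrite -RintegralD// -RintegralZl//; last exact: rintegrableD.
apply: le_Rintegral => //; first by have [] := sqintD sf sg.
  by apply: rintegrableZ; exact: rintegrableD.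
by move=> t _; have := sqr_ge0 (f t - g t); nra.
Qed.

Lemma sqnormZ k f : sqint f -> sqnorm (fun t => k * f t) = k ^+ 2 * sqnorm f.
Proof.
move=> [_ fi]; rewrite /sqnorm; under eq_Rintegral do rewrite exprMn.
by rewrite RintegralZl.
Qed.

Lemma le_sqnormBB f g h : sqint f -> sqint g -> sqint h ->
  sqnorm (fun t => f t - h t) <=
    2 * (sqnorm (fun t => f t - g t) + sqnorm (fun t => g t - h t)).
Proof.
move=> sf sg sh; rewrite [leLHS](_ : _ = sqnorm (fun t => (f t - g t) + (g t - h t))).
  by apply: le_sqnormD; exact: sqintB.
by congr sqnorm; apply/funext => t; rewrite addrA subrK.
Qed.

Lemma sqnormBC f g : sqnorm (fun t => f t - g t) = sqnorm (fun t => g t - f t).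
Proof. by apply: eq_Rintegral => t _; rewrite -sqrrN opprB. Qed.

(** The bound on [f_] passes to the limit, so (f - f_n)^2 is dominated by 4 g^2. *)
Lemma sqnorm_dominated_cvg (f_ : nat -> T -> R) f g :
  (forall n, measurable_fun setT (f_ n)) ->
  (forall t, f_ n t @[n --> \oo] --> f t) ->
  sqint g -> (forall n t, `|f_ n t| <= `|g t|) ->
  sqint f /\ sqnorm (fun t => f t - f_ n t) @[n --> \oo] --> 0.
Proof.
move=> mf cf sg fg.
have mF : measurable_fun setT f by apply: (measurable_fun_cvg mf) => t _; exact: cf.
have fle t : `|f t| <= `|g t|.
  apply: (ler_cvg_to (cvg_norm (cf t)) (cvg_cst `|g t|)).
  by apply: nearW => n; exact: fg.
split; first exact: sqint_le sg.
have I0 : \int[mu]_t 0 = 0 :> R by rewrite /Rintegral integral0.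
rewrite -[X in _ --> X]I0.
apply: (proj2 (@Rintegral_dominated_cvg _ _ _ mu (fun n t => (f t - f_ n t) ^+ 2)
  (fun=> 0) (fun t => 4 * g t ^+ 2) _ _ _ _)).
- by move=> n; apply: measurable_funX; exact: measurable_funB.
- move=> t; rewrite (_ : 0 = (f t - f t) ^+ 2); last by rewrite subrr expr0n.
  by under eq_fun do rewrite expr2; rewrite expr2; apply: cvgM; apply: cvgB => //; exact: cvg_cst.
- by apply: rintegrableZ; have [] := sg.
- move=> n t; rewrite ger0_norm ?sqr_ge0//.
  have := fle t; have := fg n t; have := normr_ge0 (f t); have := normr_ge0 (f_ n t).
  rewrite -(@real_normK _ (g t)) ?num_real//.
  have : (f t - f_ n t) ^+ 2 <= (`|f t| + `|f_ n t|) ^+ 2.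
    by rewrite -[leLHS]real_normK ?num_real// lerXn2r ?nnegrE ?addr_ge0// ler_normB.
  by nra.
Qed.

End square_integrable.

(** * Bounded pointwise closure of trigonometric polynomials *)

Section trig_closure.
Context (R : realType) (S : Type) (n : nat) (phi : 'I_n -> S -> R).

Definition linform (c : 'I_n -> R) (x : S) : R := \sum_i c i * phi i x.

(** [S] and the coordinates [phi] are abstract so that one class serves on R, on R^n and on tuples.
    Any property stable under the five rules holds on the class by induction; the uniform bound in
    [trig_lim] is what dominated convergence needs. *)
Inductive trig_closure : (S -> R) -> Prop :=
| trig_cos c : trig_closure (fun x => cos (linform c x))
| trig_sin c : trig_closure (fun x => sin (linform c x))
| trigD f g : trig_closure f -> trig_closure g -> trig_closure (fun x => f x + g x)
| trigZ k f : trig_closure f -> trig_closure (fun x => k * f x)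
| trig_lim f_ f M : (forall j : nat, trig_closure (f_ j)) ->
    (forall j x, `|f_ j x| <= M) ->
    (forall x, f_ j x @[j --> \oo] --> f x) -> trig_closure f.

Lemma linformD c1 c2 x :
  linform (fun i => c1 i + c2 i) x = linform c1 x + linform c2 x.
Proof. by rewrite -big_split; apply: eq_bigr => i _; rewrite mulrDl. Qed.

Lemma linformZ k c x : linform (fun i => k * c i) x = k * linform c x.
Proof. by rewrite mulr_sumr; apply: eq_bigr => i _; rewrite mulrA. Qed.

Lemma linform_delta i k x : linform (fun j => if j == i then k else 0) x = k * phi i x.
Proof.
rewrite /linform (bigD1 i)//= eqxx big1 ?addr0// => j ji.
by rewrite (negbTE ji) mul0r.
Qed.

Lemma trig_cst k : trig_closure (fun=> k).
Proof.
rewrite (_ : (fun=> k) = fun x => k * cos (linform (fun=> 0) x)).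
  by apply: trigZ; exact: trig_cos.
by apply/funext => x; rewrite /linform big1 ?cos0 ?mulr1// => i _; rewrite mul0r.
Qed.

Lemma trigB f g : trig_closure f -> trig_closure g -> trig_closure (fun x => f x - g x).
Proof.
move=> tf tg; rewrite (_ : (fun _ => _) = fun x => f x + (-1) * g x).
  by apply: trigD => //; exact: trigZ.
by apply/funext => x; rewrite mulN1r.
Qed.

Lemma trig_bounded f : trig_closure f -> exists M, forall x, `|f x| <= M.
Proof.
elim=> [c|c|{}f g _ [M fM] _ [N gN]|k {}f _ [M fM]|f_ {}f M _ _ fM cf].
- by exists 1 => x; rewrite ler_norml cos_geN1 cos_le1.
- by exists 1 => x; rewrite ler_norml sin_geN1 sin_le1.
- by exists (M + N) => x; rewrite (le_trans (ler_normD _ _))// lerD.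
- by exists (`|k| * M) => x; rewrite normrM ler_wpM2l.
- exists M => x; apply: (ler_cvg_to (cvg_norm (cf x)) (cvg_cst M)).
  by apply: nearW => j; exact: fM.
Qed.

(** Product-to-sum formulas in the base cases. Products are treated one factor at a time, since the
    limit rule wants the other factor fixed and bounded; a cosine and a sine kept together serve
    both base cases of [trigM]. *)
Lemma trigM_atom (a b : R) c f : trig_closure f ->
  trig_closure (fun x => (a * cos (linform c x) + b * sin (linform c x)) * f x).
Proof.
elim=> [c'|c'|{}f g _ tf _ tg|k {}f _ tf|f_ {}f M _ tf fM cf].
- pose p := linform (fun i => c i + c' i); pose q := linform (fun i => c i + (-1) * c' i).
  rewrite (_ : (fun _ => _) = fun x => (a / 2) * cos (p x) + ((a / 2) * cos (q x)
      + ((b / 2) * sin (p x) + (b / 2) * sin (q x)))).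
    by do !apply: trigD; apply: trigZ; (exact: trig_cos || exact: trig_sin).
  apply/funext => x; rewrite /p /q !linformD linformZ mulN1r !(cosD, sinD, cosN, sinN).
  by field.
- pose p := linform (fun i => c i + c' i); pose q := linform (fun i => c i + (-1) * c' i).
  rewrite (_ : (fun _ => _) = fun x => (a / 2) * sin (p x) + ((- a / 2) * sin (q x)
      + ((b / 2) * cos (q x) + (- b / 2) * cos (p x)))).
    by do !apply: trigD; apply: trigZ; (exact: trig_cos || exact: trig_sin).
  apply/funext => x; rewrite /p /q !linformD linformZ mulN1r !(cosD, sinD, cosN, sinN).
  by field.
- by under [X in trig_closure X]eq_fun do rewrite mulrDr; exact: trigD.
- by under [X in trig_closure X]eq_fun do rewrite mulrCA; exact: trigZ.
- have [N hN] : exists N, forall x, `|a * cos (linform c x) + b * sin (linform c x)| <= N.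
    by apply: trig_bounded; apply: trigD; apply: trigZ; [exact: trig_cos|exact: trig_sin].
  apply: (@trig_lim (fun j x => (a * cos (linform c x) + b * sin (linform c x)) * f_ j x)
    _ (N * M)) => [//|j x|x]; first by rewrite normrM ler_pM.
  by apply: cvgM; [exact: cvg_cst|exact: cf].
Qed.

Lemma trigM f g : trig_closure f -> trig_closure g -> trig_closure (fun x => f x * g x).
Proof.
move=> + tg; elim=> [c|c|{}f {}h _ tf _ th|k {}f _ tf|f_ {}f M _ tf fM cf].
- have := trigM_atom 1 0 c tg.
  by under [X in trig_closure X -> _]eq_fun do rewrite mul1r mul0r addr0.
- have := trigM_atom 0 1 c tg.
  by under [X in trig_closure X -> _]eq_fun do rewrite mul1r mul0r add0r.
- by under [X in trig_closure X]eq_fun do rewrite mulrDl; exact: trigD.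
- by under [X in trig_closure X]eq_fun do rewrite -mulrA; exact: trigZ.
- have [N gN] := trig_bounded tg.
  apply: (@trig_lim (fun j x => f_ j x * g x) _ (M * N)) => [//|j x|x].
    by rewrite normrM ler_pM.
  by apply: cvgM; [exact: cf|exact: cvg_cst].
Qed.

(* The iterates of s(3 - s^2)/2 converge pointwise to the sign on [-1, 1]. *)
Definition sgn_iter (j : nat) (s : R) : R := iter j (fun s => s * (3 - s ^+ 2) / 2) s.

Lemma sgn_iterN j s : sgn_iter j (- s) = - sgn_iter j s.
Proof. by elim: j => //= j; rewrite /sgn_iter /= => ->; field. Qed.

(** One step multiplies the gap 1 - t by 1 - t (1 + t) / 2, which is at most 1 - s / 2 because the
    iterates stay above s. *)
Lemma sgn_iter_bound j (s : R) : 0 < s -> s <= 1 ->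
  [/\ s <= sgn_iter j s, sgn_iter j s <= 1 & 1 - sgn_iter j s <= (1 - s / 2) ^+ j].
Proof.
move=> s0 s1; elim: j => [|j]; first by rewrite /sgn_iter/= expr0; split; lra.
rewrite /sgn_iter /= -/(sgn_iter j s); set t := sgn_iter j s => -[st t1 tj].
have p0 : 0 <= (1 - s / 2) ^+ j by apply: exprn_ge0; lra.
have t0 : 0 < t by lra.
(* [tt] is twice the increment of one step, [tt'] twice the gap to 1 that remains after it. *)
have tt : 0 <= t * ((1 - t) * (1 + t)) by rewrite !mulr_ge0//; lra.
have tt' : 0 <= (1 - t) ^+ 2 * (2 + t) by rewrite mulr_ge0 ?sqr_ge0//; lra.
rewrite [(1 - s / 2) ^+ _]exprSr; split; [lra|lra|].
rewrite (_ : 1 - _ = (1 - t) * (1 - t * (1 + t) / 2)); last by field.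
apply: (@le_trans _ _ ((1 - t) * (1 - s / 2))); first by apply: ler_wpM2l; [lra|nra].
by apply: ler_wpM2r => //; lra.
Qed.

Lemma sgn_iter_norm j s : `|s| <= 1 -> `|sgn_iter j s| <= 1.
Proof.
move=> s1; have [s0|s0|->] := ltgtP s 0; last first.
- rewrite (_ : sgn_iter _ _ = 0) ?normr0 ?ler01//.
  by elim: j => //= j; rewrite /sgn_iter/= => ->; rewrite !mul0r.
- have [h1 h2 _] := @sgn_iter_bound j s s0 (le_trans (ler_norm _) s1).
  by rewrite ger0_norm// (le_trans (ltW s0)).
- have Ns0 : 0 < - s by rewrite oppr_gt0.
  have Ns1 : - s <= 1 by rewrite (le_trans (ler_norm _))// normrN.
  have [h1 h2 _] := @sgn_iter_bound j (- s) Ns0 Ns1.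
  by rewrite -normrN -sgn_iterN ger0_norm// (le_trans (ltW Ns0)).
Qed.

Lemma sgn_iter_cvg s : `|s| <= 1 -> sgn_iter j s @[j --> \oo] --> Num.sg s.
Proof.
have pos t : 0 < t -> t <= 1 -> sgn_iter j t @[j --> \oo] --> (1 : R).
  move=> t0 t1; rewrite -[X in _ --> X](subr0 1).
  apply: (@squeeze_cvgr _ _ _ _ (fun j => 1 - (1 - t / 2) ^+ j) (fun=> 1 - 0)).
  - by apply: nearW => j; have [_ h1 h2] := @sgn_iter_bound j t t0 t1; rewrite subr0 h1 andbT; lra.
  - apply: cvgB; first exact: cvg_cst.
    by apply: cvg_expr; rewrite ger0_norm; lra.
  - exact: cvg_cst.
move=> s1; have [s0|s0|->] := ltgtP s 0; last first.
- rewrite sgr0 (_ : (fun _ => _) = fun=> 0); first exact: cvg_cst.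
  by apply/funext; elim=> //= j; rewrite /sgn_iter/= => ->; rewrite !mul0r.
- by rewrite gtr0_sg//; apply: pos => //; exact: le_trans (ler_norm _) s1.
- rewrite ltr0_sg// (_ : (fun _ => _) = fun j => - sgn_iter j (- s)).
    by apply: cvgN; apply: pos; rewrite ?oppr_gt0//; by rewrite (le_trans (ler_norm _))// normrN.
  by apply/funext => j; rewrite sgn_iterN opprK.
Qed.

Lemma trig_sgn f : trig_closure f -> (forall x, `|f x| <= 1) ->
  trig_closure (fun x => Num.sg (f x)).
Proof.
move=> tf f1; apply: (@trig_lim (fun j x => sgn_iter j (f x)) _ 1).
- elim=> [//|j IH]; rewrite /sgn_iter /=; apply: trigM; last exact: trig_cst.
  apply: trigM => //; apply: trigB; first exact: trig_cst.
  by under [X in trig_closure X]eq_fun do rewrite expr2; exact: trigM.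
- by move=> j x; exact: sgn_iter_norm.
- by move=> x; exact: sgn_iter_cvg.
Qed.

Lemma sgr_sin (t : R) : `|t| < pi -> Num.sg (sin t) = Num.sg t.
Proof.
rewrite ltr_norml => /andP[t1 t2]; have [t0|t0|->] := ltgtP t 0.
- rewrite !ltr0_sg// -oppr_gt0 -sinN sin_gt0_pi//; apply/andP; split; lra.
- by rewrite !gtr0_sg// sin_gt0_pi// t0.
- by rewrite sin0.
Qed.

(** phi - a is unbounded and has to be reached through sines: sin((phi - a) / j) has the sign of phi
    - a as soon as |phi - a| < j pi. *)
Lemma trig_sgn_phi i a : trig_closure (fun x => Num.sg (phi i x - a)).
Proof.
apply: (@trig_lim (fun j x => Num.sg (sin ((phi i x - a) / j.+1%:R))) _ 1).
- move=> j; apply: trig_sgn => [|x]; last by rewrite ler_norml sin_geN1 sin_le1.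
  pose c := fun l : 'I_n => if l == i then (j.+1%:R^-1 : R) else 0.
  rewrite (_ : (fun _ => _) = fun x => cos (- a / j.+1%:R) * sin (linform c x)
     + sin (- a / j.+1%:R) * cos (linform c x)).
    by apply: trigD; apply: trigZ; [exact: trig_sin|exact: trig_cos].
  apply/funext => x; rewrite linform_delta mulrDl sinD [_^-1 * _]mulrC; ring.
- by move=> j x; case: sgrP; rewrite ?normr0 ?normrN ?normr1.
- move=> x; set t := phi i x - a.
  apply: cvg_near_cst. near=> j.
  rewrite sgr_sin; first by rewrite sgrM [Num.sg _^-1]gtr0_sg ?mulr1// invr_gt0.
  rewrite normrM normfV [`|_.+1%:R|]ger0_norm// ltr_pdivrMr//.
  rewrite (@lt_le_trans _ _ j.+1%:R)//; last first.
    by rewrite ler_peMl// (le_trans _ (pi_ge2 _))// ler1n.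
  rewrite -natr1 ltr_wpDr//.
  near: j; exact: (@nbhs_infty_gtr R).
Unshelve. all: by end_near. Qed.

Lemma trig_indicT : trig_closure (\1_setT).
Proof.
rewrite (_ : \1_setT = fun=> 1); first exact: trig_cst.
by apply/funext => x; rewrite indicT.
Qed.

Lemma trig_indicC A : trig_closure \1_A -> trig_closure \1_(~` A).
Proof.
move=> tA; rewrite (_ : \1_(~` A) = fun x => 1 - \1_A x).
  by apply: trigB => //; exact: trig_cst.
by apply/funext => x; rewrite !indicE in_setC; case: (_ \in _); rewrite ?subrr ?subr0.
Qed.

Lemma trig_indicU A B : trig_closure \1_A -> trig_closure \1_B -> trig_closure \1_(A `|` B).
Proof.
move=> tA tB; rewrite (_ : \1_(A `|` B) = fun x => \1_A x + \1_B x - \1_A x * \1_B x).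
  by apply: trigB; [exact: trigD|exact: trigM].
apply/funext => x; rewrite !indicE in_setU.
by case: (_ \in _); case: (_ \in _); rewrite /= ?mul1r ?mul0r ?mulr0; ring.
Qed.

Lemma trig_indic_bigcup (F : nat -> set S) : (forall j, trig_closure \1_(F j)) ->
  trig_closure \1_(\bigcup_j F j).
Proof.
move=> tF; apply: (@trig_lim (fun j => \1_(\big[setU/set0]_(i < j) F i)) _ 1).
- elim=> [|j IH].
    by rewrite big_ord0 -setCT; apply: trig_indicC; exact: trig_indicT.
  by rewrite big_ord_recr; apply: trig_indicU.
- by move=> j x; rewrite indicE; case: (_ \in _); rewrite ?normr0 ?normr1.
- move=> x; rewrite [X in _ --> X]indicE; have [[k _ Fk]|nF] := pselect ((\bigcup_j F j) x).
    rewrite mem_set; last by exists k.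
    apply: cvg_near_cst; exists k.+1 => // j /= kj.
    rewrite indicE mem_set// -bigcup_mkord; exists k => //.
  rewrite memNset//; apply: cvg_near_cst; apply: nearW => j.
  by rewrite indicE memNset// -bigcup_mkord => -[l _ Fl]; apply: nF; exists l.
Qed.

Lemma trig_indic_sigma_algebra : sigma_algebra setT [set A | trig_closure \1_A].
Proof.
split => /=.
- by rewrite -setCT; apply: trig_indicC; exact: trig_indicT.
- by move=> A tA; rewrite setTD; exact: trig_indicC.
- exact: trig_indic_bigcup.
Qed.

(** The sets whose indicator lies in the class form a sigma-algebra, so rays in a single coordinate
    suffice. *)
Lemma trig_indic A : g_sigma_preimage phi A -> trig_closure \1_A.
Proof.
suff : g_sigma_preimage phi `<=` [set A | trig_closure \1_A] by apply.
apply: smallest_sub; first exact: trig_indic_sigma_algebra.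
rewrite -bigcup_seq => B [i /= _ [C mC <-]]; rewrite setTI {B}.
have [D0 DD DU] := trig_indic_sigma_algebra.
(* The Borel sets of R are generated by the open rays below a point. *)
have {}mC : <<s @RGenInftyO.G R >> C.
  by have := RGenInftyO.measurableE R; rewrite /measurable/= => <-.
suff : <<s @RGenInftyO.G R >> `<=` [set C | trig_closure \1_(phi i @^-1` C)] by apply.
apply: smallest_sub.
  split => /=; first by rewrite preimage_set0.
    by move=> C' tC; rewrite setTD preimage_setC -setTD; exact: DD.
  by move=> F tF; rewrite preimage_bigcup; exact: DU.
move=> _ [a ->] /=.
(* For a sign s, (s^2 - s) / 2 is 1 at s = -1 and 0 at s = 0 and s = 1, which is the open ray. *)
rewrite (_ : \1_ _ = fun x => 2^-1 * (Num.sg (phi i x - a) * Num.sg (phi i x - a)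
    - Num.sg (phi i x - a))).
  apply: trigZ; apply: trigB; last exact: trig_sgn_phi.
  by apply: trigM; exact: trig_sgn_phi.
apply/funext => x; rewrite indicE (_ : (x \in _) = (phi i x - a < 0)); last first.
  by rewrite subr_lt0; apply/idP/idP; rewrite inE/= in_itv.
by have [h|h|->] := ltgtP (phi i x - a) 0; rewrite ?(ltr0_sg h) ?(gtr0_sg h) ?sgr0 /=; field.
Qed.

Lemma trig_measurable d (T : measurableType d) (X : T -> S) h :
  (forall i, measurable_fun setT (phi i \o X)) ->
  trig_closure h -> measurable_fun setT (h \o X).
Proof.
move=> mX; have ml c : measurable_fun setT (fun t => linform c (X t)).
  apply: measurable_sum => i; apply: measurable_funM => //; exact: mX.
elim=> [c|c|{}f g _ mf _ mg|k {}f _ mf|f_ {}f M _ mf fM cf].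
- by apply: measurableT_comp (ml c); apply: continuous_measurable_fun; exact: continuous_cos.
- by apply: measurableT_comp (ml c); apply: continuous_measurable_fun; exact: continuous_sin.
- exact: measurable_funD.
- exact: measurable_funM.
- by apply: (measurable_fun_cvg mf) => t _; exact: cf.
Qed.

Lemma trig_rintegrable d (T : measurableType d) (P : probability T R) (X : T -> S) h :
  (forall i, measurable_fun setT (phi i \o X)) ->
  trig_closure h -> rintegrable P (h \o X).
Proof.
move=> mX th; have [M hM] := trig_bounded th.
apply: (@rintegrable_le _ _ _ _ _ (fun=> M)); first exact: trig_measurable.
- by move=> t; exact: hM.
- by apply: finite_measure_integrable_cst.
Qed.

Section uniqueness.
Context d1 (T1 : measurableType d1) (P1 : probability T1 R) (X1 : T1 -> S).
Context d2 (T2 : measurableType d2) (P2 : probability T2 R) (X2 : T2 -> S).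
Hypothesis mX1 : forall i, measurable_fun setT (phi i \o X1).
Hypothesis mX2 : forall i, measurable_fun setT (phi i \o X2).
Hypothesis eq_cos : forall c,
  \int[P1]_t cos (linform c (X1 t)) = \int[P2]_t cos (linform c (X2 t)).
Hypothesis eq_sin : forall c,
  \int[P1]_t sin (linform c (X1 t)) = \int[P2]_t sin (linform c (X2 t)).

(** The hypotheses settle cosines and sines; bounded limits follow because constants are integrable
    for a probability. *)
Lemma trig_Rintegral h : trig_closure h -> \int[P1]_t h (X1 t) = \int[P2]_t h (X2 t).
Proof.
elim=> [//|//|{}f g tf ef tg eg|k {}f tf ef|f_ {}f M tf ef fM cf].
- by rewrite !RintegralD// ?ef ?eg//; exact: trig_rintegrable.
- by rewrite !RintegralZl// ?ef//; exact: trig_rintegrable.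
- have cvg d (T : measurableType d) (P : probability T R) (X : T -> S) :
      (forall i, measurable_fun setT (phi i \o X)) ->
      \int[P]_t f_ j (X t) @[j --> \oo] --> \int[P]_t f (X t).
    move=> mX; apply: (proj2 (@Rintegral_dominated_cvg _ _ _ P
      (fun j => f_ j \o X) (f \o X) (fun=> M) _ _ _ _)).
    + by move=> j; exact: trig_measurable.
    + by move=> t; exact: cf.
    + by apply: finite_measure_integrable_cst.
    + by move=> j t; exact: fM.
  have c1 := cvg _ _ P1 _ mX1; have c2 := cvg _ _ P2 _ mX2.
  rewrite (_ : (fun _ => _) = fun j => \int[P2]_t f_ j (X2 t)) in c1; last first.
    by apply/funext => j; exact: ef.
  exact: (cvg_unique (@norm_hausdorff _ _) c1 c2).
Qed.

Lemma law_unique A : g_sigma_preimage phi A -> P1 (X1 @^-1` A) = P2 (X2 @^-1` A).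
Proof.
move=> /trig_indic tA; have := trig_Rintegral tA.
have E d (T : measurableType d) (P : probability T R) (X : T -> S) :
    (forall i, measurable_fun setT (phi i \o X)) ->
    (\int[P]_t \1_A (X t))%:E = P (X @^-1` A).
  move=> mX; rewrite EFin_Rintegral; last exact: trig_rintegrable.
  rewrite -[X in P X]setIT -integral_indic//.
  by apply/measurable_indicP; exact: (trig_measurable mX tA).
by rewrite -(E _ _ P1 X1 mX1) -(E _ _ P2 X2 mX2) => ->.
Qed.

End uniqueness.

End trig_closure.

(** * Gaussian characteristic functions *)

Section trig_derivative.
Context (R : realType).

Lemma cos_lipschitz (u v : R) : `|cos u - cos v| <= `|u - v|.
Proof.
wlog uv : u v / v <= u.
  by move=> H; have [/H//|/ltW/H] := leP v u; rewrite distrC [leRHS]distrC.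
have [c _ ->] := @MVT_segment _ cos (fun x => - sin x) v u uv
  (fun x _ => is_derive_cos x) (continuous_subspaceT (@continuous_cos R)).
by rewrite normrM normrN ler_piMl// ler_norml sin_geN1 sin_le1.
Qed.

Lemma sin_lipschitz (u v : R) : `|sin u - sin v| <= `|u - v|.
Proof.
wlog uv : u v / v <= u.
  by move=> H; have [/H//|/ltW/H] := leP v u; rewrite distrC [leRHS]distrC.
have [c _ ->] := @MVT_segment _ sin cos v u uv
  (fun x _ => is_derive_sin x) (continuous_subspaceT (@continuous_sin R)).
by rewrite normrM ler_piMl// ler_norml cos_geN1 cos_le1.
Qed.

Lemma is_derive_quotient (f : R -> R) (a l : R) : is_derive a 1 f l ->
  h^-1 * (f (h + a) - f a) @[h --> 0^'] --> l.
Proof.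
move=> [df dl]; rewrite -dl; move: df; rewrite /derivable /derive.
by under eq_fun do rewrite /= /GRing.scale/= mulr1.
Qed.

Lemma quotient_is_derive (f : R -> R) (a l : R) :
  h^-1 * (f (h + a) - f a) @[h --> 0^'] --> l -> is_derive a 1 f l.
Proof.
move=> fl; have : h^-1 *: ((f \o shift a) (h *: 1) - f a) @[h --> 0^'] --> l.
  by under eq_fun do rewrite /= /GRing.scale/= mulr1.
move=> {}fl; split; first by apply/cvg_ex; exists l.
exact/cvg_lim.
Qed.

Lemma cos_diff_quotient (a b : R) :
  h^-1 * (cos (a + h * b) - cos a) @[h --> 0^'] --> - (b * sin a).
Proof.
pose f h := cos (a + h * b).
have df : is_derive (0 : R) 1 f (- (b * sin a)).
  rewrite /f; apply: is_derive_eq.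
  by rewrite /GRing.scale /= ?mul0r ?mulr0 ?addr0 ?add0r ?mulr1; ring.
have := is_derive_quotient df; rewrite /f.
by under eq_fun do rewrite addr0 mul0r addr0.
Qed.

(** Used twice: for the normal characteristic function, with b = x - m, and for the covariance, with
    b a multiple of a coordinate. The Lipschitz bound on the cosine dominates the quotients by |b G|
    uniformly in h. *)
Lemma Rintegral_cos_derive d (T : measurableType d) (mu : {measure set T -> \bar R})
    (a b G : T -> R) : measurable_fun setT a -> measurable_fun setT b ->
    rintegrable mu G -> rintegrable mu (fun t => b t * G t) ->
  rintegrable mu (fun t => b t * sin (a t) * G t) /\
  h^-1 * (\int[mu]_t (cos (a t + h * b t) * G t) - \int[mu]_t (cos (a t) * G t))
    @[h --> 0^'] --> - \int[mu]_t (b t * sin (a t) * G t).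
Proof.
move=> ma mb iG ibG; have mG := rintegrable_measurable iG.
have mcos (f : T -> R) : measurable_fun setT f -> measurable_fun setT (fun t => cos (f t)).
  exact: (measurableT_comp (continuous_measurable_fun (@continuous_cos R))).
have msin (f : T -> R) : measurable_fun setT f -> measurable_fun setT (fun t => sin (f t)).
  exact: (measurableT_comp (continuous_measurable_fun (@continuous_sin R))).
have mab h : measurable_fun setT (fun t => a t + h * b t).
  by apply: measurable_funD => //; exact: measurable_funM.
have icos (f : T -> R) : measurable_fun setT f -> rintegrable mu (fun t => cos (f t) * G t).
  move=> mf; apply: (rintegrable_le _ _ (integrable_norm iG)).
    by apply: measurable_funM => //; exact: mcos.
  by move=> t; rewrite normrM ler_piMl// ler_norml cos_geN1 cos_le1.
have ibs : rintegrable mu (fun t => b t * sin (a t) * G t).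
  apply: (rintegrable_le _ _ (integrable_norm ibG)).
    by do 2 apply: measurable_funM => //; exact: msin.
  move=> t /=; rewrite mulrAC normrM ler_piMr//.
  by rewrite ler_norml sin_geN1 sin_le1.
split => //.
pose F h t := h^-1 * (cos (a t + h * b t) - cos (a t)) * G t.
have [] := @Rintegral_dominated_dnbhs _ _ _ mu F
  (fun t => - (b t * sin (a t)) * G t) (fun t => `|b t * G t|) 0.
- move=> h; apply: measurable_funM => //; apply: measurable_funM => //.
  by apply: measurable_funB; exact: mcos.
- by move=> t; apply: cvgM; [exact: cos_diff_quotient|exact: cvg_cst].
- exact: integrable_norm.
- move=> h t h0; rewrite /F !normrM ler_wpM2r// normfV ler_pdivrMl ?normr_gt0//.
  by rewrite -normrM (le_trans (cos_lipschitz _ _))// addrAC subrr add0r.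
move=> _; rewrite (_ : \int[mu]_t _ = - \int[mu]_t (b t * sin (a t) * G t)); last first.
  rewrite -mulN1r -RintegralZl//; apply: eq_Rintegral => t _; ring.
rewrite (_ : (fun x => \int[mu]_t F x t) = (fun h => h^-1 *
  (\int[mu]_t (cos (a t + h * b t) * G t) - \int[mu]_t (cos (a t) * G t))))//.
apply/funext => h; rewrite -RintegralB//; [|exact: icos|exact: icos].
rewrite -RintegralZl//; last by apply: rintegrableB; exact: icos.
by apply: eq_Rintegral => t _; rewrite /F; ring.
Qed.

End trig_derivative.

(** Integration by parts over the whole line: the fundamental theorem on growing intervals with
    integer endpoints, then dominated convergence. *)
Lemma Rintegral_derive0 (R : realType) (H h : R -> R) :
  (forall x : R, is_derive x (1 : R) H (h x)) -> continuous h ->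
  rintegrable lebesgue_measure h ->
  H n%:R @[n --> \oo] --> 0 -> H (- n%:R) @[n --> \oo] --> 0 ->
  \int[lebesgue_measure]_x h x = 0.
Proof.
move=> dH ch ih H1 H2.
pose I n := `[(- n.+1%:R : R), n.+1%:R]%classic.
have cH : continuous H.
  by move=> x; apply: differentiable_continuous; apply/derivable1_diffP; case: (dH x).
have E n : \int[lebesgue_measure]_x (\1_(I n) x * h x) = H n.+1%:R - H (- n.+1%:R).
  have n0 : - n.+1%:R < n.+1%:R :> R by rewrite gtrN.
  have E1 : (\int[lebesgue_measure]_(x in I n) (h x)%:E =
      (H n.+1%:R)%:E - (H (- n.+1%:R))%:E)%E.
    apply: continuous_FTC2 => //.
    - exact: continuous_subspaceT.
    - split => [x _||]; first by case: (dH x).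
        by apply: cvg_at_right_filter; exact: cH.
      by apply: cvg_at_left_filter; exact: cH.
    - by move=> x _; rewrite derive1E; exact: derive_val.
  rewrite /Rintegral -[RHS]/(fine ((H n.+1%:R)%:E - (H (- n.+1%:R))%:E)%E) -E1.
  rewrite [in RHS]integral_mkcond; congr fine; apply: eq_integral => x _.
  by rewrite patchE indicE; case: (_ \in _); rewrite ?mul1r ?mul0r.
have [||||_ c] := @Rintegral_dominated_cvg _ _ _ (@lebesgue_measure R)
  (fun n x => \1_(I n) x * h x) h (fun x => `|h x|).
- move=> n; apply: measurable_funM; last exact: rintegrable_measurable ih.
  by apply: measurable_indic; exact: measurable_itv.
- move=> x; apply: cvg_near_cst; near=> n.
  rewrite indicE mem_set ?mul1r// /I /= in_itv/= -ler_norml.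
  by rewrite -natr1 ler_wpDr// ltW//; near: n; exact: (@nbhs_infty_gtr R).
- exact: integrable_norm.
- by move=> n x; rewrite indicE; case: (_ \in _); rewrite ?mul1r// mul0r normr0.
have c0 : H n.+1%:R - H (- n.+1%:R) @[n --> \oo] --> 0.
  rewrite -[X in _ --> X](subr0 0); apply: cvgB.
    by have := H1; rewrite -(cvg_shiftS (fun n => H n%:R)).
  by have := H2; rewrite -(cvg_shiftS (fun n => H (- n%:R))).
rewrite (_ : (fun _ => _) = fun n => H n.+1%:R - H (- n.+1%:R)) in c; last first.
  by apply/funext => n; exact: E.
exact: (cvg_unique (@norm_hausdorff _ _) c c0).
Unshelve. all: by end_near. Qed.

(** * Characteristic function of the normal law *)

Section normal_pdf.
Context (R : realType) (m s : R).
Hypothesis s0 : s != 0.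
Notation p := (normal_pdf m s).
Notation leb := (@lebesgue_measure R).

Lemma normal_pdf_val x :
  p x = normal_peak s * expR (- (x - m) ^+ 2 / (s ^+ 2 *+ 2)).
Proof. by rewrite normal_pdfE. Qed.

Lemma is_derive_normal_pdf (x : R) : is_derive x (1 : R) p (- (x - m) / s ^+ 2 * p x).
Proof.
rewrite (_ : p = fun x => normal_peak s * expR (- (x - m) ^+ 2 / (s ^+ 2 *+ 2))).
  apply: is_derive_eq; rewrite /GRing.scale /=.
  by field.
by apply/funext => y; exact: normal_pdf_val.
Qed.

(** A normal density of doubled variance dominates. With y = x - m and z = y^2 / (4 s^2), p(x) is
    proportional to e^{-z} e^{-z}, and |y| e^{-z} <= 1 + 4 s^2 because e^z >= 1 + z. In [C], the
    ratio of peaks adjusts the normalization. *)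
Lemma rintegrable_normal_moment1 : rintegrable leb (fun x => (x - m) * p x).
Proof.
have s2 : Num.sqrt 2 * s != 0 by rewrite mulf_neq0// gt_eqF// sqrtr_gt0.
pose q := normal_pdf m (Num.sqrt 2 * s).
pose C := normal_peak s / normal_peak (Num.sqrt 2 * s) * (1 + 4 * s ^+ 2).
have iq : rintegrable leb (fun x => C * q x).
  by apply: rintegrableZ; exact: integrable_normal_pdf.
apply: (rintegrable_le _ _ iq).
  apply: measurable_funM; last exact: measurable_normal_pdf.
  exact: measurable_funB.
move=> x; rewrite normrM [`|p x|]ger0_norm ?normal_pdf_ge0// /q normal_pdf_val normal_pdfE//.
rewrite /normal_fun exprMn sqr_sqrtr// /C.
set y := x - m; set k := normal_peak s; set l := normal_peak _.
have l0 : l != 0 by rewrite gt_eqF// normal_peak_gt0.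
rewrite [leRHS](_ : _ = k * ((1 + 4 * s ^+ 2) * expR (- y ^+ 2 / (2 * s ^+ 2 *+ 2))));
  last by field.
rewrite mulrCA ler_wpM2l ?normal_peak_ge0//.
set z := y ^+ 2 / (4 * s ^+ 2).
have s20 : 0 < s ^+ 2 by rewrite exprn_even_gt0.
have -> : - y ^+ 2 / (s ^+ 2 *+ 2) = - z - z.
  by rewrite /z -mulr_natr; field.
have -> : - y ^+ 2 / (2 * s ^+ 2 *+ 2) = - z by rewrite /z -mulr_natr; field.
rewrite expRD mulrA ler_wpM2r ?expR_ge0// expRN ler_pdivrMr ?expR_gt0//.
apply: (@le_trans _ _ ((1 + 4 * s ^+ 2) * (1 + z))); last first.
  by rewrite ler_wpM2l ?expR_ge1Dx// addr_ge0// mulr_ge0// ltW.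
have -> : (1 + 4 * s ^+ 2) * (1 + z) = 1 + 4 * s ^+ 2 + y ^+ 2 / (4 * s ^+ 2) + y ^+ 2.
  by rewrite /z; field.
have : 0 <= y ^+ 2 / (4 * s ^+ 2) by rewrite divr_ge0 ?sqr_ge0// mulr_ge0// ltW.
have := normr_ge0 y; have : `|y| ^+ 2 = y ^+ 2 by rewrite real_normK ?num_real.
by nra.
Qed.

(** Completing the square gives y^2 / (2 s^2) >= |y| - s^2 / 2 for y = x - m. The bound serves to
    make p vanish at infinity. *)
Lemma normal_pdf_le_expR x :
  p x <= normal_peak s * expR (s ^+ 2 / 2 + `|m|) * expR (- `|x|).
Proof.
rewrite normal_pdf_val -mulrA ler_wpM2l ?normal_peak_ge0// -expRD ler_expR.
have s20 : 0 < s ^+ 2 by rewrite exprn_even_gt0.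
have H : `|x| <= `|x - m| + `|m| by rewrite -{1}(subrK m x) ler_normD.
have : 0 <= (`|x - m| - s ^+ 2) ^+ 2 / (s ^+ 2 *+ 2).
  by rewrite divr_ge0 ?sqr_ge0// mulrn_wge0// ltW.
rewrite sqrrB real_normK ?num_real// !mulrDl.
have -> : - (`|x - m| * s ^+ 2 *+ 2) / (s ^+ 2 *+ 2) = - `|x - m|.
  by field.
have -> : (s ^+ 2) ^+ 2 / (s ^+ 2 *+ 2) = s ^+ 2 / 2 by field.
by rewrite mulNr; lra.
Qed.

Lemma cvg_normal_pdf (u : nat -> R) : (forall n, `|u n| = n%:R) ->
  p (u n) @[n --> \oo] --> 0.
Proof.
move=> un; pose K := normal_peak s * expR (s ^+ 2 / 2 + `|m|).
apply: (@squeeze_cvgr _ _ _ _ (fun=> 0) (fun n => K * expR (- n%:R))).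
- by apply: nearW => n; rewrite normal_pdf_ge0/= -un normal_pdf_le_expR.
- exact: cvg_cst.
- rewrite -[X in _ --> X](mulr0 K); apply: cvgM; first exact: cvg_cst.
  exact: (cvg_comp _ _ (@cvgr_idn R) (@cvgr_expR R)).
Qed.

(** The derivative of cos(th (x - m) + phi) p(x) integrates to 0, and p' = -(x - m) p / s^2. The
    free phase also yields the version with cosine and sine exchanged. *)
Lemma normal_by_parts (th phi : R) :
  rintegrable leb (fun x => (x - m) * cos (th * (x - m) + phi) * p x) /\
  \int[leb]_x ((x - m) * cos (th * (x - m) + phi) * p x) =
    - (s ^+ 2 * th) * \int[leb]_x (sin (th * (x - m) + phi) * p x).
Proof.
have mu : measurable_fun setT (fun x : R => th * (x - m) + phi).
  by apply: measurable_funD => //; apply: measurable_funM => //; exact: measurable_funB.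
have ip := integrable_normal_pdf m s.
have i1 : rintegrable leb (fun x => sin (th * (x - m) + phi) * p x).
  apply: (rintegrable_le _ _ ip); first apply: measurable_funM.
  - exact: (measurableT_comp (continuous_measurable_fun (@continuous_sin R))).
  - exact: measurable_normal_pdf.
  - move=> x; rewrite normrM [`|p x|]ger0_norm ?normal_pdf_ge0//.
    by rewrite ler_piMl ?normal_pdf_ge0// ler_norml sin_geN1 sin_le1.
have i2 : rintegrable leb (fun x => (x - m) * cos (th * (x - m) + phi) * p x).
  apply: (rintegrable_le _ _ (integrable_norm rintegrable_normal_moment1)).
    apply: measurable_funM; last exact: measurable_normal_pdf.
    apply: measurable_funM; first exact: measurable_funB.
    exact: (measurableT_comp (continuous_measurable_fun (@continuous_cos R))).
  move=> x /=; rewrite mulrAC [leLHS]normrM ler_piMr//.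
  by rewrite ler_norml cos_geN1 cos_le1.
split => //.
pose H x := cos (th * (x - m) + phi) * p x.
pose h x := - th * (sin (th * (x - m) + phi) * p x)
   + - (s ^+ 2)^-1 * ((x - m) * cos (th * (x - m) + phi) * p x).
have dH (x : R) : is_derive x (1 : R) H (h x).
  have dp := is_derive_normal_pdf x.
  apply: is_derive_eq; rewrite /GRing.scale /= /h.
  by field.
have cp := @continuous_normal_pdf R m s s0.
have cu : continuous (fun x : R => th * (x - m) + phi).
  move=> x; apply: cvgD; last exact: cvg_cst.
  by apply: cvgM; [exact: cvg_cst|apply: cvgB; [exact: cvg_id|exact: cvg_cst]].
have ch : continuous h.
  move=> x; apply: cvgD; apply: cvgM; try exact: cvg_cst; apply: cvgM; try exact: cp.
    by apply: continuous_comp; [exact: cu|exact: continuous_sin].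
  apply: cvgM; first by apply: cvgB; [exact: cvg_id|exact: cvg_cst].
  by apply: continuous_comp; [exact: cu|exact: continuous_cos].
have bH x : `|H x| <= p x.
  rewrite normrM [`|p x|]ger0_norm ?normal_pdf_ge0//.
  by rewrite ler_piMl ?normal_pdf_ge0// ler_norml cos_geN1 cos_le1.
have cH (u : nat -> R) : (forall n, `|u n| = n%:R) -> H (u n) @[n --> \oo] --> 0.
  move=> un; apply: norm_cvg0.
  apply: (@squeeze_cvgr _ _ _ _ (fun=> 0) (fun n => p (u n))).
  - by apply: nearW => n; rewrite normr_ge0 bH.
  - exact: cvg_cst.
  - exact: cvg_normal_pdf.
have := @Rintegral_derive0 _ H h dH ch (rintegrableD (rintegrableZ _ i1) (rintegrableZ _ i2))
  (cH _ (fun n => normr_nat _ _)) (cH _ (fun n => etrans (normrN _) (normr_nat _ _))).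
rewrite RintegralD//; [|exact: rintegrableZ|exact: rintegrableZ].
rewrite !RintegralZl// => E; have s20 : s ^+ 2 != 0 by rewrite expf_neq0.
move/eqP: E; rewrite addr_eq0 mulNr mulNr opprK => /eqP /(congr1 (fun y => s ^+ 2 * y)).
by rewrite mulVKf// => <-; ring.
Qed.

(** The integral solves f' = - s^2 t f, so f(t) exp(s^2 t^2 / 2) is constant. The phase [psi]
    delivers the real and imaginary parts of the characteristic function together. *)
Lemma normal_char (th psi : R) :
  \int[leb]_x (cos (th * x + psi) * p x) =
    cos (th * m + psi) * expR (- (s ^+ 2 * th ^+ 2 / 2)).
Proof.
(* The phase is frozen at the frequency [th], so that only the centered variable x - m oscillates
   with t. *)
pose phi := th * m + psi.
pose f t := (\int[leb]_x (cos (t * (x - m) + phi) * p x)).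
have ip := integrable_normal_pdf m s.
have mx : measurable_fun setT (fun x : R => x - m) by exact: measurable_funB.
have df (t : R) : is_derive t (1 : R) f (- (s ^+ 2 * t) * f t).
  apply: quotient_is_derive.
  have mu : measurable_fun setT (fun x : R => t * (x - m) + phi).
    by apply: measurable_funD => //; exact: measurable_funM.
  have [_] := @Rintegral_cos_derive R _ _ leb _ _ _ mu mx ip rintegrable_normal_moment1.
  rewrite (_ : - (\int[leb]_x ((x - m) * sin (t * (x - m) + phi) * p x)) =
      - (s ^+ 2 * t) * f t); last first.
    (* Advancing the phase by pi / 2 turns the cosine there into the sine produced by
       differentiation. *)
    have [i1] := normal_by_parts t (phi + pi / 2).
    under eq_Rintegral do rewrite addrA cosDpihalf.
    under [in RHS]eq_Rintegral do rewrite addrA sinDpihalf.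
    move=> E; rewrite [RHS](_ : _ = \int[leb]_x ((x - m) * - sin (t * (x - m) + phi) * p x));
      last exact: esym E.
    rewrite -[LHS]mulN1r -RintegralZl//; first by apply: eq_Rintegral => x _; ring.
    have := rintegrableZ (-1) i1; congr (rintegrable _ _); apply/funext => x.
    by rewrite addrA cosDpihalf; ring.
  rewrite (_ : (fun _ => _) = fun h => h^-1 * (f (h + t) - f t))//.
  apply/funext => h; congr (_ * (_ - _)); apply: eq_Rintegral => x _.
  by congr (cos _ * _); ring.
have f0 : f 0 = cos phi.
  rewrite /f; under eq_Rintegral do rewrite mul0r add0r.
  rewrite RintegralZl// /Rintegral integral_normal_pdf/=; ring.
pose g t := f t * expR (s ^+ 2 * t ^+ 2 / 2).
have dg (t : R) : is_derive t (1 : R) g 0.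
  have := df t => dft.
  apply: is_derive_eq; rewrite /GRing.scale /=. by field.
have := is_derive_0_is_cst th 0 dg.
rewrite /g expr0n/= mulr0 mul0r expR0 mulr1 f0 expRN => <-.
rewrite mulfK ?gt_eqF ?expR_gt0//; apply: eq_Rintegral => x _.
by congr (cos _ * _); rewrite /phi; ring.
Qed.

End normal_pdf.

Lemma cos_subpihalf (R : realType) (x : R) : cos (x - pi / 2) = sin x.
Proof. by rewrite cosB cos_pihalf sin_pihalf mulr0 mulr1 add0r. Qed.

(** The Radon-Nikodym derivative of the normal law is identified with its density almost everywhere,
    by comparing integrals over measurable sets. *)
Lemma Rintegral_normal_prob (R : realType) (m s : R) (f : R -> R) :
  rintegrable (normal_prob m s) f ->
  \int[normal_prob m s]_x f x = \int[lebesgue_measure]_x (f x * normal_pdf m s x).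
Proof.
move=> fi; rewrite /Rintegral; congr fine.
rewrite -(Radon_Nikodym_change_of_variables (normal_prob_dominates m s))//=.
apply: ae_eq_integral => //.
- apply: emeasurable_funM; first exact: measurable_int fi.
  apply: (measurable_int lebesgue_measure).
  by apply: Radon_Nikodym_integrable; exact: normal_prob_dominates.
- apply/measurable_EFinP/measurable_funM; last exact: measurable_normal_pdf.
  exact: rintegrable_measurable fi.
- rewrite (_ : (fun x => (f x * normal_pdf m s x)%:E) =
      ((EFin \o f) \* (EFin \o normal_pdf m s))%E)//.
  apply: ae_eqe_mul2l => /=.
  rewrite Radon_NikodymE//=; first exact: normal_prob_dominates.
  move=> numu; case: cid => /= h [h1 h2 h3].
  apply: integral_ae_eq => //=.
  + by apply/measurable_EFinP; exact: measurable_normal_pdf.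
  + by move=> E _ mE; rewrite -h3.
Qed.

(** * Quotients that read moments off a characteristic function near 0 *)

Section trig_limits.
Context (R : realType).

Definition shrink n : R := n.+1%:R^-1.

Lemma shrink_gt0 n : 0 < shrink n. Proof. by rewrite invr_gt0. Qed.

Lemma cvg_shrink : shrink n @[n --> \oo] --> 0. Proof. exact: cvg_harmonic. Qed.

Lemma sin_quotient_cvg (y : R) : sin (shrink n * y) / shrink n @[n --> \oo] --> y.
Proof.
pose f h := sin (h * y).
have df : is_derive (0 : R) 1 f y.
  by rewrite /f; apply: is_derive_eq; rewrite /GRing.scale /= !mul0r cos0; ring.
have := is_derive_quotient df.
rewrite (_ : (fun _ => _) = fun h => sin (h * y) / h); last first.
  by apply/funext => h; rewrite /f addr0 mul0r sin0 subr0 mulrC.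
move=> /cvgr_dnbhsP; apply; split=> [n|]; last exact: cvg_shrink.
by rewrite gt_eqF// shrink_gt0.
Qed.

(** 1 - cos(u y) = 2 sin(u y / 2)^2 reduces this to the sine quotient at y / 2. *)
Lemma cos_quotient_cvg (y : R) :
  2 * (1 - cos (shrink n * y)) / shrink n ^+ 2 @[n --> \oo] --> y ^+ 2.
Proof.
have c := @sin_quotient_cvg (y / 2).
have -> : y ^+ 2 = 4 * (y / 2 * (y / 2)) by field.
rewrite (_ : (fun _ => _) = fun n => 4 * (sin (shrink n * (y / 2)) / shrink n *
    (sin (shrink n * (y / 2)) / shrink n))).
  by apply: cvgM; [exact: cvg_cst|exact: cvgM].
apply/funext => n; have := shrink_gt0 n; move: (shrink n) => u u0.
have -> : u * y = u * (y / 2) + u * (y / 2) by field.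
rewrite cosD; have := cos2Dsin2 (u * (y / 2)).
set C := cos _; set S := sin _ => CS.
have -> : 1 - (C * C - S * S) = 2 * (S * S) by rewrite -[X in X - _]CS; ring.
by field; rewrite gt_eqF.
Qed.

(** y e^{-y} <= 1 - e^{-y} <= y at y = v u^2 / 2 squeezes the quotient between v e^{-y} and v. *)
Lemma expR_quotient_cvg (v : R) :
  2 * (1 - expR (- (v * shrink n ^+ 2 / 2))) / shrink n ^+ 2 @[n --> \oo] --> v.
Proof.
have c0 : v * expR (- (v * shrink n ^+ 2 / 2)) @[n --> \oo] --> v * expR (- (v * (0 * 0) / 2)).
  apply: cvgM; first exact: cvg_cst.
  apply: (cvg_comp _ expR); last exact: continuous_expR.
  apply: cvgN; apply: cvgM; last exact: cvg_cst.
  apply: cvgM; first exact: cvg_cst.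
  by under eq_fun do rewrite expr2; apply: cvgM; exact: cvg_shrink.
rewrite !mulr0 mul0r oppr0 expR0 mulr1 in c0.
apply: (squeeze_cvgr _ c0 (cvg_cst v)).
apply: nearW => n; have := shrink_gt0 n; move: (shrink n) => u u0.
have uu : 0 < u ^+ 2 by rewrite exprn_gt0.
rewrite ler_pdivlMr// ler_pdivrMr//; set y := v * u ^+ 2 / 2.
have yE : v * u ^+ 2 = 2 * y by rewrite /y; field.
have H1 := expR_ge1Dx (- y); rewrite yE mulrAC yE -mulrA !ler_pM2l//.
have : expR (- y) * (1 + y) <= 1.
  by rewrite expRN ler_pdivrMl ?expR_gt0// mulr1 expR_ge1Dx.
by move=> H2; apply/andP; split; nra.
Qed.

Lemma onem_cos_le (y : R) : 2 * (1 - cos y) <= y ^+ 2.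
Proof.
have := sin_lipschitz (y / 2) 0; rewrite sin0 !subr0.
have -> : cos y = cos (y / 2 + y / 2) by congr cos; field.
rewrite cosD; have := cos2Dsin2 (y / 2).
set C := cos _; set S := sin _ => CS Sy.
have : `|S| ^+ 2 <= `|y / 2| ^+ 2 by rewrite lerXn2r ?nnegrE.
by rewrite !real_normK ?num_real// => ?; lra.
Qed.

End trig_limits.

(** * Centered Gaussian variables *)

Section gaussian.
Context (R : realType) d (T : measurableType d) (P : probability T R).
Implicit Types X Y : T -> R.

Lemma rintegrable_cst k : rintegrable P (fun=> k).
Proof. exact: finite_measure_integrable_cst. Qed.

Lemma rintegrable_bounded X M : measurable_fun setT X -> (forall t, `|X t| <= M) ->
  rintegrable P X.
Proof. by move=> mX XM; apply: rintegrable_le XM (rintegrable_cst M). Qed.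

Lemma measurable_cos X : measurable_fun setT X -> measurable_fun setT (fun t => cos (X t)).
Proof. exact: (measurableT_comp (continuous_measurable_fun (@continuous_cos R))). Qed.

Lemma measurable_sin X : measurable_fun setT X -> measurable_fun setT (fun t => sin (X t)).
Proof. exact: (measurableT_comp (continuous_measurable_fun (@continuous_sin R))). Qed.

Lemma rintegrable_cos X : measurable_fun setT X -> rintegrable P (fun t => cos (X t)).
Proof.
move=> mX; apply: (@rintegrable_bounded _ 1) => [|t]; first exact: measurable_cos.
by rewrite ler_norml cos_geN1 cos_le1.
Qed.

Lemma rintegrable_sin X : measurable_fun setT X -> rintegrable P (fun t => sin (X t)).
Proof.
move=> mX; apply: (@rintegrable_bounded _ 1) => [|t]; first exact: measurable_sin.
by rewrite ler_norml sin_geN1 sin_le1.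
Qed.

Lemma Rintegral_prob_cst k : \int[P]_t k = k.
Proof.
transitivity (k * fine (P setT)); first exact: Rintegral_cst.
by rewrite probability_setT mulr1.
Qed.

(* Centered Gaussian law of variance [v], through its characteristic function. *)
Definition cgauss X v := [/\ measurable_fun setT X,
  forall th, \int[P]_t cos (th * X t) = expR (- (v * th ^+ 2 / 2)) &
  forall th, \int[P]_t sin (th * X t) = 0].

(** Fatou: 2 (1 - cos(h X)) / h^2 tends to X^2 and has expectation 2 (1 - e^{-v h^2 / 2}) / h^2 <=
    v. Once X^2 is integrable, it dominates the same quotients and [cgauss_sqnorm] gets the exact
    variance. *)
Lemma cgauss_sqint X v : 0 <= v -> cgauss X v -> sqint P X.
Proof.
move=> v0 [mX cX _]; split => //.
have mq (h : R) : measurable_fun setT (fun t => 2 * (1 - cos (h * X t)) / h ^+ 2).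
  apply: measurable_funM => //; apply: measurable_funM => //; apply: measurable_funB => //.
  by apply: measurable_cos; exact: measurable_funM.
pose u : nat -> R := @shrink R.
have q0 (h : R) t : 0 <= 2 * (1 - cos (h * X t)) / h ^+ 2.
  by rewrite divr_ge0 ?sqr_ge0// mulr_ge0// subr_ge0 cos_le1.
have Iq n : \int[P]_t (2 * (1 - cos (u n * X t)) / u n ^+ 2) <= v.
  have u0 : 0 < u n ^+ 2 by rewrite exprn_gt0// shrink_gt0.
  have iq : rintegrable P (fun t => 1 - cos (u n * X t)).
    apply: rintegrableB; first exact: rintegrable_cst.
    by apply: rintegrable_cos; exact: measurable_funM.
  under eq_Rintegral do rewrite mulrAC.
  rewrite RintegralZl// RintegralB//; last 2 first.
    exact: rintegrable_cst.
    by apply: rintegrable_cos; exact: measurable_funM.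
  rewrite Rintegral_prob_cst cX -mulrAC ler_pdivrMr//.
  have := expR_ge1Dx (- (v * u n ^+ 2 / 2)); lra.
have lim t : ((2 * (1 - cos (u n * X t)) / u n ^+ 2)%:E @[n --> \oo] --> (X t ^+ 2)%:E)%E.
  by apply: cvg_EFin; [exact: nearW|exact: cos_quotient_cvg].
apply/integrableP; split; first by apply/measurable_EFinP; exact: measurable_funX.
have := @fatou _ _ _ P _ measurableT (fun n t => (2 * (1 - cos (u n * X t)) / u n ^+ 2)%:E)
  (fun n => iffRL (measurable_EFinP _ _) (mq (u n))) (fun n t _ => q0 (u n) t).
under [X in (X <= _)%E -> _]eq_integral => t _.
  rewrite (cvg_limn_einf_sup (lim t)).
  over.
move=> H; under eq_integral do rewrite /= ger0_norm ?sqr_ge0//.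
apply: (le_lt_trans H); apply: (@le_lt_trans _ _ v%:E); last exact: ltry.
rewrite limn_einf_lim; apply: lime_le; first exact: is_cvg_einfs.
apply: nearW => n; apply: (le_trans (ereal_inf_lbound _)).
  by exists n => /=.
rewrite -EFin_Rintegral ?lee_fin ?Iq//.
apply: (@rintegrable_bounded _ (4 / u n ^+ 2)) => // t.
rewrite ger0_norm// ler_wpM2r ?invr_ge0 ?sqr_ge0//.
by have := cos_geN1 (u n * X t); lra.
Qed.

Lemma rintegrable_sqint X : sqint P X -> rintegrable P X.
Proof.
move=> sX; have s1 : sqint P (fun=> 1) by split => //; exact: rintegrable_cst.
have := sqintM sX s1.
by under [X in rintegrable _ X -> _]eq_fun do rewrite mulr1.
Qed.

Lemma cgauss_sqnorm X v : 0 <= v -> cgauss X v -> sqnorm P X = v.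
Proof.
move=> v0 gX; have [mX iX] := cgauss_sqint v0 gX; have [_ cX _] := gX.
have [||||_ c] := @Rintegral_dominated_cvg _ _ _ P
  (fun n t => 2 * (1 - cos (shrink R n * X t)) / shrink R n ^+ 2) (fun t => X t ^+ 2)
  (fun t => X t ^+ 2).
- move=> n; apply: measurable_funM => //; apply: measurable_funM => //.
  by apply: measurable_funB => //; apply: measurable_cos; exact: measurable_funM.
- by move=> t; exact: cos_quotient_cvg.
- exact: iX.
- move=> n t; have := shrink_gt0 R n; move: (shrink R n) => u u0.
  rewrite ger0_norm; last by rewrite divr_ge0 ?sqr_ge0// mulr_ge0// subr_ge0 cos_le1.
  rewrite ler_pdivrMr ?exprn_gt0// -exprMn [X t * u]mulrC.
  exact: onem_cos_le.
have c2 := @expR_quotient_cvg R v.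
apply: (cvg_unique (@norm_hausdorff _ _) c).
rewrite (_ : (fun _ => _) = fun n =>
  2 * (1 - expR (- (v * shrink R n ^+ 2 / 2))) / shrink R n ^+ 2)//.
apply/funext => n; rewrite -cX.
have mu : measurable_fun setT (fun t => shrink R n * X t) by exact: measurable_funM.
under eq_Rintegral do rewrite mulrAC.
rewrite RintegralZl//; last by apply: rintegrableB; [exact: rintegrable_cst|exact: rintegrable_cos].
rewrite RintegralB//; [|exact: rintegrable_cst|exact: rintegrable_cos].
by rewrite Rintegral_prob_cst mulrAC.
Qed.

(** sin(u X) / u tends to X, is dominated by |X| and has expectation 0. *)
Lemma cgauss_mean X v : 0 <= v -> cgauss X v -> \int[P]_t X t = 0.
Proof.
move=> v0 gX; have [mX iX] := cgauss_sqint v0 gX; have [_ _ sX] := gX.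
have [||||_ c] := @Rintegral_dominated_cvg _ _ _ P
  (fun n t => sin (shrink R n * X t) / shrink R n) X (fun t => `|X t|).
- move=> n; apply: measurable_funM => //.
  by apply: measurable_sin; exact: measurable_funM.
- by move=> t; exact: sin_quotient_cvg.
- exact: integrable_norm (rintegrable_sqint (cgauss_sqint v0 gX)).
- move=> n t; have := shrink_gt0 R n; move: (shrink R n) => u u0.
  rewrite normrM normfV (gtr0_norm u0) ler_pdivrMr//.
  by have := sin_lipschitz (u * X t) 0; rewrite sin0 !subr0 [leRHS]normrM
    (gtr0_norm u0) [leRHS]mulrC.
apply: (cvg_unique (@norm_hausdorff _ _) c).
rewrite (_ : (fun _ => _) = fun n => 0); first exact: cvg_cst.
apply/funext => n.
have mu : measurable_fun setT (fun t => shrink R n * X t) by exact: measurable_funM.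
under eq_Rintegral do rewrite mulrC.
by rewrite RintegralZl// ?sX ?mulr0//; exact: rintegrable_sin.
Qed.

(** One formula with a phase covers cosine and sine, as well as the Dirac laws. *)
Lemma gaussian_char X : measurable_fun setT X -> gaussian_rv P X ->
  exists m s : R, forall th psi,
    \int[P]_t cos (th * X t + psi) = cos (th * m + psi) * expR (- (s ^+ 2 * th ^+ 2 / 2)).
Proof.
move=> mX [m [s gX]]; exists m, s => th psi.
have mc : measurable_fun setT (fun x : R => cos (th * x + psi)).
  apply: (measurableT_comp (continuous_measurable_fun (@continuous_cos R))).
  by apply: measurable_funD => //; exact: measurable_funM.
have cle (x : R) : `|cos x| <= 1 by rewrite ler_norml cos_geN1 cos_le1.
pose Y : {RV P >-> measurableTypeR R} :=
  HB.pack X (@isMeasurableFun.Build _ _ T (measurableTypeR R) X mX).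
have -> : \int[P]_t cos (th * X t + psi) = \int[distribution P Y]_x cos (th * x + psi).
  rewrite /Rintegral integral_distribution//; first exact/measurable_EFinP.
  apply: (@rintegrable_bounded (fun t => cos (th * X t + psi)) 1) => //.
  exact: (measurableT_comp mc).
have [s0|s0] := eqVneq s 0; last first.
  rewrite -(normal_char m s0) -Rintegral_normal_prob.
    rewrite /Rintegral; congr fine; apply: eq_measure_integral => A mA _.
    by have := gX A mA; rewrite (negbTE s0).
  apply: (@rintegrable_le _ (measurableTypeR R) _ _ _ _ mc)
    (finite_measure_integrable_cst _ 1 measurableT).
  by move=> x; exact: cle.
rewrite s0 expr0n/= !mul0r oppr0 expR0 mulr1 /Rintegral.
rewrite (@eq_measure_integral _ (measurableTypeR R) _ _ (@dirac _ (measurableTypeR R) m R)).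
  by rewrite integral_dirac// ?diracT ?mul1e//; exact/measurable_EFinP.
by move=> A mA _; have := gX A mA; rewrite s0 eqxx.
Qed.

(** [m] is not known to be the mean at the outset: X - m satisfies [cgauss], hence has mean 0, which
    forces m = E X = 0. *)
Lemma gaussian_cgauss X : measurable_fun setT X -> gaussian_rv P X ->
  ('E_P[X] = 0)%E -> exists2 v, 0 <= v & cgauss X v.
Proof.
move=> mX gX EX; have [m [s cX]] := gaussian_char mX gX.
have mXm : measurable_fun setT (fun t => X t - m) by exact: measurable_funB.
have gXm : cgauss (fun t => X t - m) (s ^+ 2).
  split => // th.
    under eq_Rintegral do rewrite mulrBr.
    by rewrite cX subrr cos0 mul1r.
  under eq_Rintegral do rewrite -cos_subpihalf mulrBr -addrA.
  by rewrite cX addrA subrr add0r cosN cos_pihalf mul0r.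
have s0 : 0 <= s ^+ 2 by exact: sqr_ge0.
suff m0 : m = 0.
  exists (s ^+ 2) => //; move: gXm; rewrite m0.
  by under [X in cgauss X _ -> _]eq_fun do rewrite subr0.
have := cgauss_mean s0 gXm; have iXm := rintegrable_sqint (cgauss_sqint s0 gXm).
have iX : rintegrable P X.
  have := rintegrableD iXm (rintegrable_cst m).
  by under [X in rintegrable _ X -> _]eq_fun do rewrite subrK.
rewrite RintegralB//; last exact: rintegrable_cst.
rewrite Rintegral_prob_cst {1}/Rintegral; move: EX; rewrite unlock => ->/=.
by rewrite sub0r => /eqP; rewrite oppr_eq0 => /eqP.
Qed.

(** Uniqueness of the law with a single coordinate, the identity; for v = 0 the law to compare with
    is a Dirac measure. *)
Lemma cgauss_gaussian X v : 0 <= v -> cgauss X v -> gaussian_rv P X.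
Proof.
move=> v0 [mX cX sX]; exists 0, (Num.sqrt v) => A mA.
pose phi (i : 'I_1) (x : R) := x.
have mid i : measurable_fun [set: measurableTypeR R] (phi i \o idfun) by exact: measurable_id.
have mXi i : measurable_fun setT (phi i \o X) by exact: mX.
have gA : g_sigma_preimage phi A.
  apply: sub_sigma_algebra; rewrite big_ord1; exists A => //.
  by rewrite setTI.
have lin c x : linform phi c x = c ord0 * x by rewrite /linform big_ord1.
rewrite sqrtr_eq0; case: ifPn => [v0'|vpos].
  have vE : v = 0 by apply/eqP; rewrite eq_le v0' v0.
  apply: (@law_unique R R 1 phi _ _ P X _ (measurableTypeR R)
    (@dirac _ (measurableTypeR R) (0 : R) R) idfun mXi mid _ _ A gA) => c.
    under eq_Rintegral do rewrite lin; rewrite cX vE !mul0r oppr0 expR0.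
    under eq_Rintegral do rewrite lin.
    rewrite /Rintegral integral_dirac//= ?mulr0 ?cos0 ?indicT ?mulr1//.
    by apply/measurable_EFinP;
      apply: (measurableT_comp (continuous_measurable_fun (@continuous_cos R))).
  under eq_Rintegral do rewrite lin; rewrite sX.
  under eq_Rintegral do rewrite lin.
  rewrite /Rintegral integral_dirac//= ?mulr0 ?sin0 ?mulr0//.
  by apply/measurable_EFinP;
      apply: (measurableT_comp (continuous_measurable_fun (@continuous_sin R))).
rewrite -ltNge in vpos.
have s0 : Num.sqrt v != 0 by rewrite gt_eqF// sqrtr_gt0.
have ib (f : R -> R) : measurable_fun setT f -> (forall x, `|f x| <= 1) ->
    rintegrable (normal_prob 0 (Num.sqrt v)) f.
  by move=> mf f1; apply: (@rintegrable_le _ (measurableTypeR R) _ _ _ _ mf f1)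
    (finite_measure_integrable_cst _ 1 measurableT).
apply: (@law_unique R R 1 phi _ _ P X _ (measurableTypeR R)
    (normal_prob 0 (Num.sqrt v)) idfun mXi mid _ _ A gA) => c.
  under eq_Rintegral do rewrite lin; rewrite cX.
  under eq_Rintegral do rewrite lin.
  rewrite Rintegral_normal_prob; last first.
    apply: ib => [|x]; last by rewrite ler_norml cos_geN1 cos_le1.
    apply: (measurableT_comp (continuous_measurable_fun (@continuous_cos R))).
    exact: (measurable_funM (measurable_cst (c ord0)) (@measurable_id _ _ setT)).
  under eq_Rintegral do rewrite -[c _ * _]addr0.
  by rewrite normal_char// mulr0 addr0 cos0 mul1r sqr_sqrtr.
under eq_Rintegral do rewrite lin; rewrite sX.
under eq_Rintegral do rewrite lin.
rewrite Rintegral_normal_prob; last first.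
  apply: ib => [|x]; last by rewrite ler_norml sin_geN1 sin_le1.
  apply: (measurableT_comp (continuous_measurable_fun (@continuous_sin R))).
    exact: (measurable_funM (measurable_cst (c ord0)) (@measurable_id _ _ setT)).
under eq_Rintegral do rewrite -cos_subpihalf.
by rewrite normal_char// mulr0 add0r cosN cos_pihalf mul0r.
Qed.

End gaussian.

(** * Extension of a Gaussian isometry *)

Section completeness.
Context (R : realType) d (T : measurableType d) (mu : {measure set T -> \bar R}).

(** The rate 8 is 4 times 2: after weighting by 4^n the integrals are at most 2^{-n}, hence
    summable, and [S] is finite almost everywhere. *)
Lemma sqint_summable_cauchy (X : nat -> T -> R) : (forall n, sqint mu (X n)) ->
  (forall n, sqnorm mu (fun t => X n.+1 t - X n t) <= 8^-1 ^+ n) ->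
  {ae mu, forall t, cvgn (fun n => X n t)}.
Proof.
move=> sX dX; pose D n t := 4 ^+ n * (X n.+1 t - X n t) ^+ 2.
have D0 n t : 0 <= D n t. by rewrite /D; apply: mulr_ge0; [exact: exprn_ge0|exact: sqr_ge0].
have iD n : rintegrable mu (D n) by apply: rintegrableZ; apply: (proj2 (sqintB (sX _) (sX _))).
have mD n : measurable_fun setT (EFin \o D n).
  by apply/measurable_EFinP; exact: rintegrable_measurable (iD n).
pose S t := (\sum_(n <oo) (D n t)%:E)%E.
have S0 t : (0 <= S t)%E by apply: nneseries_ge0 => n _ _; rewrite lee_fin.
have mS : measurable_fun setT S.
  apply: (@ge0_emeasurable_sum _ _ _ setT (fun n t => (D n t)%:E) xpredT).
    by move=> n t _ _; rewrite lee_fin.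
  by move=> n _; exact: mD.
have iS : mu.-integrable setT S.
  apply/integrableP; split => //.
  under eq_integral do rewrite gee0_abs//.
  rewrite integral_nneseries//; last by move=> n t _; rewrite lee_fin.
  apply: (@le_lt_trans _ _ 2%:E); last exact: ltry.
  apply: lime_le.
    by apply: is_cvg_nneseries => n _ _; apply: integral_ge0 => t _; rewrite lee_fin.
  (* The bound 2 is sharpened to the exact partial sum of the 2^{-k}, which goes through the
     induction. *)
  apply: nearW => n; apply: (@le_trans _ _ (2 - 2 * 2^-1 ^+ n)%:E).
    elim: n => [|n IH]; first by rewrite big_geq// expr0 mulr1 subrr.
    rewrite big_nat_recr//= (le_trans (leeD IH (lexx _)))// -EFin_Rintegral//.
    rewrite -EFinD lee_fin RintegralZl//; last by apply: (proj2 (sqintB (sX _) (sX _))).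
    have -> : 2 - 2 * 2^-1 ^+ n.+1 = 2 - 2 * 2^-1 ^+ n + 4 ^+ n * 8^-1 ^+ n :> R.
      rewrite -exprMn (_ : 4 / 8 = 2^-1) ?exprS; by field.
    by rewrite lerD2l ler_wpM2l ?exprn_ge0//; exact: dX.
  by rewrite lee_fin gerBl mulr_ge0// exprn_ge0.
(* The weights [4 ^ n] make the increments geometric wherever [S] is finite. *)
have := integrable_ae measurableT iS; apply: filterS => t /(_ I) fS.
have [C SC] : exists C, S t = C%:E by exists (fine (S t)); rewrite fineK.
have C0 : 0 <= C by rewrite -lee_fin -SC.
have DC n : D n t <= C.
  rewrite -lee_fin -SC.
  apply: (@le_trans _ _ (\sum_(0 <= k < n.+1) (D k t)%:E)%E); last first.
    by apply: nneseries_lim_ge => k _; rewrite lee_fin.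
  by rewrite big_nat_recr//= leeDr// sume_ge0// => k _; rewrite lee_fin.
have dB n : `|X n.+1 t - X n t| <= Num.sqrt C * 2^-1 ^+ n.
  rewrite exprVn ler_pdivlMr ?exprn_gt0// -[2 ^+ n]ger0_norm ?exprn_ge0// -normrM -sqrtr_sqr.
  rewrite ler_wsqrtr// (le_trans _ (DC n))// /D exprMn -exprM mulnC exprM mulrC.
  by rewrite (_ : 2 ^+ 2 = 4)//; ring.
have cs : cvgn (series (telescope (fun n => X n t))).
  apply: normed_cvg; apply: (series_le_cvg _ _ dB) => [n|n|]; rewrite ?normr_ge0//.
  by apply: is_cvg_geometric_series; rewrite ger0_norm//; lra.
rewrite (_ : (fun n => X n t) = fun n => X 0%N t + series (telescope (fun n => X n t)) n).
  by apply: is_cvgD; [exact: is_cvg_cst|exact: cs].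
by apply/funext => n; rewrite -eq_sum_telescope.
Qed.

(** Riesz-Fischer with a rate: the almost everywhere limit inherits each bound by Fatou. *)
Lemma sqint_complete (X : nat -> T -> R) : (forall n, sqint mu (X n)) ->
  (forall n k, (n <= k)%N -> sqnorm mu (fun t => X k t - X n t) <= 8^-1 ^+ n) ->
  exists2 Y, sqint mu Y & forall n, sqnorm mu (fun t => Y t - X n t) <= 8^-1 ^+ n.
Proof.
move=> sX dX.
have aX : {ae mu, forall t, cvgn (fun n => X n t)}.
  by apply: sqint_summable_cauchy => // n; exact: dX.
have mX n : measurable_fun setT (X n) by case: (sX n).
(* The upper limit is measurable everywhere and equals the limit wherever that exists; [fine]
   changes values only on the exceptional null set. *)
pose Y t := fine (limn_esup (fun n => (X n t)%:E)).
have mY : measurable_fun setT Y.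
  apply: (measurableT_comp (fine_measurable measurableT)).
  by apply: measurable_fun_limn_esup => n; apply/measurable_EFinP.
have aY : {ae mu, forall t, X n t @[n --> \oo] --> Y t}.
  apply: filterS aX => t /cvg_ex[l Xl].
  rewrite /Y (cvg_limn_einf_sup (_ : (X n t)%:E @[n --> \oo] --> l%:E))//.
  by apply: cvg_EFin Xl; exact: nearW.
(* Fatou in k at fixed n: the lower limit of (X_{k+n} - X_n)^2 is (Y - X_n)^2 almost everywhere. *)
have YX n : (\int[mu]_t ((Y t - X n t) ^+ 2)%:E <= (8^-1 ^+ n)%:E)%E.
  have mq k : measurable_fun setT (fun t => ((X (k + n)%N t - X n t) ^+ 2)%:E).
    by apply/measurable_EFinP/measurable_funX/measurable_funB.
  rewrite (@ge0_ae_eq_integral _ _ _ mu setT _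
     (fun t => limn_einf (fun k => ((X (k + n)%N t - X n t) ^+ 2)%:E)))//=.
  - apply: (le_trans (fatou mu measurableT mq _)).
      by move=> k t _; rewrite lee_fin sqr_ge0.
    rewrite limn_einf_lim; apply: lime_le; first exact: is_cvg_einfs.
    apply: nearW => N; apply: (le_trans (ereal_inf_lbound _)).
      by exists N => /=.
    rewrite -EFin_Rintegral; last by apply: (proj2 (sqintB (sX _) (sX _))).
    by rewrite lee_fin dX// leq_addl.
  - by apply/measurable_EFinP/measurable_funX/measurable_funB.
  - rewrite (_ : (fun _ => _) = fun t =>
        (- limn_esup (fun k => - ((X (k + n)%N t - X n t) ^+ 2)%:E))%E).
      apply: measurableT_comp => //; apply: measurable_fun_limn_esup => k.
      exact: measurableT_comp (mq k).
    apply/funext => t; rewrite -[LHS]oppeK -limn_esupN; congr (- limn_esup _)%E.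
  - by move=> t _; rewrite lee_fin sqr_ge0.
  - move=> t _; rewrite limn_einf_lim; apply: lime_ge; first exact: is_cvg_einfs.
    by apply: nearW => N; apply: le_ereal_inf_tmp => _ [k _ <-]; rewrite lee_fin sqr_ge0.
  - apply: filterS aY => t Xt _.
    rewrite (cvg_limn_einf_sup (_ : _ @[k --> \oo] --> ((Y t - X n t) ^+ 2)%:E))//.
    apply: cvg_EFin; first exact: nearW.
    under eq_fun do rewrite /= expr2; rewrite expr2.
    by apply: cvgM; apply: cvgB; rewrite ?(cvg_shiftn n (fun k => X k t))//; exact: cvg_cst.
have sYX n : sqint mu (fun t => Y t - X n t).
  split; first exact: measurable_funB.
  apply/integrableP; split; first by apply/measurable_EFinP/measurable_funX/measurable_funB.
  under eq_integral do rewrite /= ger0_norm ?sqr_ge0//.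
  exact: (le_lt_trans (YX n) (ltry _)).
exists Y.
  have := sqintD (sYX 0%N) (sX 0%N).
  by under [X in sqint _ X -> _]eq_fun do rewrite subrK.
move=> n; rewrite -lee_fin EFin_Rintegral ?YX//.
by case: (sYX n).
Qed.

End completeness.

(** Coefficients and indices are kept apart from the functions, so that one list can be applied to
    the deterministic family and to the random one: this is how the isometry is transported. *)
Definition comb (R : realType) (I S : Type) (s : seq (R * I)) (g : I -> S -> R) : S -> R :=
  fun t => \sum_(p <- s) p.1 * g p.2 t.

Section comb.
Context (R : realType) (I S : Type).
Implicit Types (s : seq (R * I)) (g : I -> S -> R).

Lemma comb_nil g : comb [::] g = fun=> 0.
Proof. by apply/funext => t; rewrite /comb big_nil. Qed.

Lemma comb_cons p s g t : comb (p :: s) g t = p.1 * g p.2 t + comb s g t.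
Proof. by rewrite /comb big_cons. Qed.

Lemma comb1 k i g t : comb [:: (k, i)] g t = k * g i t.
Proof. by rewrite /comb big_seq1. Qed.

Lemma comb_cat s1 s2 g t : comb (s1 ++ s2) g t = comb s1 g t + comb s2 g t.
Proof. by rewrite /comb big_cat. Qed.

Definition comb_scale k s : seq (R * I) := [seq (k * p.1, p.2) | p <- s].

Lemma comb_scaleE k s g t : comb (comb_scale k s) g t = k * comb s g t.
Proof.
by rewrite /comb big_map mulr_sumr; apply: eq_bigr => p _; rewrite mulrA.
Qed.

Lemma comb_ord m (c : 'I_m -> R) (x : 'I_m -> I) g t :
  comb [seq (c j, x j) | j <- index_enum 'I_m] g t = \sum_j c j * g (x j) t.
Proof. by rewrite /comb big_map. Qed.

End comb.

Lemma comb_sqint (R : realType) (I : Type) d (T : measurableType d) (mu : {measure set T -> \bar R})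
  (s : seq (R * I))  (h : I -> T -> R) : (forall i, sqint mu (h i)) -> sqint mu (comb s h).
Proof.
move=> sh; elim: s => [|p s IH]; first by rewrite comb_nil; exact: sqint0.
rewrite (_ : comb _ _ = fun t => p.1 * h p.2 t + comb s h t).
  by apply: sqintD => //; exact: sqintZ.
by apply/funext => t; exact: comb_cons.
Qed.

Section norm_estimates.
Context (R : realType) d (T : measurableType d) (mu : {measure set T -> \bar R}).

(** With w = u - v, u^2 - v^2 = 2 u w - w^2 and |2 u w| <= h u^2 + w^2 / h. For |w|^2 of integral at
    most h^2 the right-hand side tends to 0 with h. *)
Lemma sqnorm_perturb (u v : T -> R) (h : R) : 0 < h -> sqint mu u -> sqint mu v ->
  `|sqnorm mu u - sqnorm mu v| <=
    h * sqnorm mu u + (h^-1 + 1) * sqnorm mu (fun t => u t - v t).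
Proof.
move=> h0 su sv; have suv := sqintB su sv.
have [[_ iu] [_ iv]] := (su, sv); have [_ iuv] := suv.
rewrite /sqnorm -RintegralB// -!RintegralZl// -RintegralD//; last 2 first.
- exact: rintegrableZ.
- exact: rintegrableZ.
have ir : rintegrable mu (fun t => h * u t ^+ 2 + (h^-1 + 1) * (u t - v t) ^+ 2).
  by apply: rintegrableD; exact: rintegrableZ.
apply: (le_trans (le_normr_Rintegral measurableT (rintegrableB iu iv))).
apply: le_Rintegral => //; first exact: integrable_norm (rintegrableB iu iv).
move=> t _; have hh : h * h^-1 = 1 by rewrite divff// gt_eqF.
have h'0 : 0 < h^-1 by rewrite invr_gt0.
set a := u t; set w := a - v t.
have -> : v t = a - w by rewrite /w; ring.
have : 0 <= h * (a - h^-1 * w) ^+ 2 by rewrite mulr_ge0 ?sqr_ge0// ltW.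
have : 0 <= h * (a + h^-1 * w) ^+ 2 by rewrite mulr_ge0 ?sqr_ge0// ltW.
have -> : h * (a + h^-1 * w) ^+ 2 = h * a ^+ 2 + 2 * a * w + h^-1 * w ^+ 2.
  by field; rewrite gt_eqF.
have -> : h * (a - h^-1 * w) ^+ 2 = h * a ^+ 2 - 2 * a * w + h^-1 * w ^+ 2.
  by field; rewrite gt_eqF.
have -> : a ^+ 2 - (a - w) ^+ 2 = 2 * a * w - w ^+ 2 by ring.
have := sqr_ge0 w; rewrite ler_norml => ? ? ?; apply/andP; split; lra.
Qed.

Lemma sqnorm_cvg (u : T -> R) (v : nat -> T -> R) : sqint mu u ->
  (forall n, sqint mu (v n)) ->
  (forall n, sqnorm mu (fun t => u t - v n t) <= shrink R n ^+ 2) ->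
  sqnorm mu (v n) @[n --> \oo] --> sqnorm mu u.
Proof.
move=> su sv uv; apply/subr_cvg0; apply: norm_cvg0.
pose b n := shrink R n * sqnorm mu u + (shrink R n + shrink R n * shrink R n).
apply: (@squeeze_cvgr _ _ _ _ (fun=> 0) b).
- apply: nearW => n; rewrite normr_ge0 distrC.
  rewrite (le_trans (sqnorm_perturb (shrink_gt0 R n) su (sv n)))// lerD2l.
  have := uv n; have := shrink_gt0 R n; move: (shrink R n) => h h0.
  have h'0 : 0 < h^-1 + 1 by rewrite addr_gt0// invr_gt0.
  move=> /(ler_wpM2l (ltW h'0)) /le_trans; apply.
  by rewrite le_eqVlt; apply/orP; left; apply/eqP; field; rewrite gt_eqF.
- exact: cvg_cst.
- rewrite (_ : 0 = 0 * sqnorm mu u + (0 + 0 * 0)); last by rewrite !mul0r !addr0.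
  have c := @cvg_shrink R.
  by apply: cvgD; [apply: cvgM => //; exact: cvg_cst|apply: cvgD => //; exact: cvgM].
Qed.

End norm_estimates.

(** * Mean-square limits of Gaussian variables *)

Section gaussian_limit.
Context (R : realType) d (T : measurableType d) (P : probability T R).

(** |w| <= h + w^2 / h turns a squared distance of at most h^2 into a difference of expectations of
    at most 2 K h. *)
Lemma Rintegral_lipschitz_cvg (F : R -> R) (K : R) (X : T -> R) (Y : nat -> T -> R) :
  (forall x, `|F x| <= 1) -> (forall x y, `|F x - F y| <= K * `|x - y|) -> 0 <= K ->
  measurable_fun setT F -> sqint P X -> (forall n, sqint P (Y n)) ->
  (forall n, sqnorm P (fun t => X t - Y n t) <= shrink R n ^+ 2) ->
  \int[P]_t F (Y n t) @[n --> \oo] --> \int[P]_t F (X t).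
Proof.
move=> F1 FK K0 mF sX sY XY.
have iF (Z : T -> R) : measurable_fun setT Z -> rintegrable P (F \o Z).
  move=> mZ; apply: (@rintegrable_bounded _ _ _ P _ 1); last by move=> t; exact: F1.
  exact: (measurableT_comp mF).
have [mX _] := sX; have mY n : measurable_fun setT (Y n) by case: (sY n).
apply/subr_cvg0; apply: norm_cvg0.
apply: (@squeeze_cvgr _ _ _ _ (fun=> 0) (fun n => 2 * K * shrink R n)).
- apply: nearW => n; rewrite normr_ge0 distrC /=.
  have sXY := sqintB sX (sY n); have [_ iXY] := sXY.
  have := XY n; have := shrink_gt0 R n; move: (shrink R n) => h h0 XYh.
  rewrite -RintegralB//; [|exact: iF|exact: iF].
  apply: (le_trans (le_normr_Rintegral measurableT (rintegrableB (iF _ mX) (iF _ (mY n))))).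
  have ir : rintegrable P (fun t => K * (h + h^-1 * (X t - Y n t) ^+ 2)).
    by apply: rintegrableZ; apply: rintegrableD; [exact: rintegrable_cst|exact: rintegrableZ].
  apply: (@le_trans _ _ (\int[P]_t (K * (h + h^-1 * (X t - Y n t) ^+ 2)))).
    apply: le_Rintegral => //.
      exact: integrable_norm (rintegrableB (iF _ mX) (iF _ (mY n))).
    move=> t _ /=; rewrite (le_trans (FK _ _))// ler_wpM2l//.
    set w := X t - Y n t.
    have hh : h^-1 * h = 1 by rewrite mulVf// gt_eqF.
    have : 0 <= h^-1 * (`|w| - h) ^+ 2 by rewrite mulr_ge0 ?sqr_ge0// invr_ge0 ltW.
    rewrite (_ : h^-1 * _ = h^-1 * `|w| ^+ 2 - 2 * `|w| + h); last by field; rewrite gt_eqF.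
    rewrite real_normK ?num_real//; have := normr_ge0 w; lra.
  rewrite RintegralZl//; last by apply: rintegrableD; [exact: rintegrable_cst|exact: rintegrableZ].
  rewrite RintegralD//; [|exact: rintegrable_cst|exact: rintegrableZ].
  rewrite Rintegral_prob_cst RintegralZl// [2 * K]mulrC -[leRHS]mulrA ler_wpM2l//.
  have : h^-1 * sqnorm P (fun t => X t - Y n t) <= h^-1 * h ^+ 2.
    by rewrite ler_wpM2l// invr_ge0 ltW.
  by rewrite expr2 mulKf ?gt_eqF// /sqnorm; lra.
- exact: cvg_cst.
- rewrite -[X in _ --> X](mulr0 (2 * K)); apply: cvgM; first exact: cvg_cst.
  exact: cvg_shrink.
Qed.

Lemma cgauss_limit (X : T -> R) (Y : nat -> T -> R) (w : nat -> R) v :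
  sqint P X -> (forall n, sqint P (Y n)) -> (forall n, cgauss P (Y n) (w n)) ->
  (forall n, sqnorm P (fun t => X t - Y n t) <= shrink R n ^+ 2) ->
  w n @[n --> \oo] --> v -> cgauss P X v.
Proof.
move=> sX sY gY XY wv; have [mX _] := sX; split => // th.
- have c1 := @Rintegral_lipschitz_cvg (fun x => cos (th * x)) `|th| X Y _ _ _ _ sX sY XY.
  apply: (cvg_unique (@norm_hausdorff _ _) (c1 _ _ _ _)) => //.
  + by move=> x; rewrite ler_norml cos_geN1 cos_le1.
  + by move=> x y; rewrite -normrM mulrBr; exact: cos_lipschitz.
  + apply: (measurableT_comp (continuous_measurable_fun (@continuous_cos R))).
    exact: measurable_funM.
  rewrite (_ : (fun _ => _) = fun n => expR (- (w n * th ^+ 2 / 2))); last first.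
    by apply/funext => n; case: (gY n).
  apply: (cvg_comp _ expR); last exact: continuous_expR.
  apply: cvgN; apply: cvgM; last exact: cvg_cst.
  by apply: cvgM => //; exact: cvg_cst.
- have c1 := @Rintegral_lipschitz_cvg (fun x => sin (th * x)) `|th| X Y _ _ _ _ sX sY XY.
  apply: (cvg_unique (@norm_hausdorff _ _) (c1 _ _ _ _)) => //.
  + by move=> x; rewrite ler_norml sin_geN1 sin_le1.
  + by move=> x y; rewrite -normrM mulrBr; exact: sin_lipschitz.
  + apply: (measurableT_comp (continuous_measurable_fun (@continuous_sin R))).
    exact: measurable_funM.
  rewrite (_ : (fun _ => _) = fun n => 0); first exact: cvg_cst.
  by apply/funext => n; case: (gY n).
Qed.

End gaussian_limit.

Section gaussian_extension.
Context (R : realType) (I : Type) dS (S : measurableType dS) (mu : {measure set S -> \bar R}).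
Context dT (T : measurableType dT) (P : probability T R).
Variables (e : I -> S -> R) (f : I -> T -> R).
Hypothesis sqint_e : forall i, sqint mu (e i).
Hypothesis gauss_f : forall s, cgauss P (comb s f) (sqnorm mu (comb s e)).

Let sqint_comb_e s : sqint mu (comb s e).
Proof. exact: comb_sqint. Qed.

Let sqint_comb_f s : sqint P (comb s f).
Proof. exact: cgauss_sqint (sqnorm_ge0 _ _) (gauss_f s). Qed.

(** A difference of two combinations is the combination of one concatenated list, whose variance
    [gauss_f] prescribes. *)
Let comb_isometry s1 s2 : sqnorm P (fun t => comb s1 f t - comb s2 f t) =
  sqnorm mu (fun t => comb s1 e t - comb s2 e t).
Proof.
have E (A : Type) (g : I -> A -> R) :
    (fun t => comb s1 g t - comb s2 g t) = comb (s1 ++ comb_scale (-1) s2) g.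
  by apply/funext => t; rewrite comb_cat comb_scaleE mulN1r.
by rewrite !E (cgauss_sqnorm (sqnorm_ge0 _ _) (gauss_f _)).
Qed.

Definition in_closure (u : S -> R) := sqint mu u /\
  forall eps, 0 < eps -> exists s, sqnorm mu (fun t => u t - comb s e t) < eps.

(* [X] is the image of [u] under the isometry that extends [e i |-> f i]. *)
Definition extends (u : S -> R) (X : T -> R) := [/\ sqint mu u, sqint P X &
  forall eps, 0 < eps -> exists s, sqnorm mu (fun t => u t - comb s e t) < eps /\
    sqnorm P (fun t => X t - comb s f t) < eps].

Lemma extends_exists u : in_closure u -> exists X, extends u X.
Proof.
(* Two approximations of [u] are compared through [u]: 2 (8^{-k} / 4 + 8^{-n} / 4) <= 8^{-n} for n
   <= k. *)
move=> [su cu]; have e0 n : 0 < 8^-1 ^+ n / 4 :> R by rewrite divr_gt0// exprn_gt0.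
have [s us] := choice (fun n => cu _ (e0 n)).
have dX n k : (n <= k)%N ->
    sqnorm P (fun t => comb (s k) f t - comb (s n) f t) <= 8^-1 ^+ n.
  move=> nk; rewrite comb_isometry.
  apply: (le_trans (le_sqnormBB (sqint_comb_e _) su (sqint_comb_e _))).
  rewrite sqnormBC.
  have := us n; have := us k.
  have : 8^-1 ^+ k <= 8^-1 ^+ n :> R.
    by apply: ler_wiXn2l => //; lra.
  by lra.
have [X sX XE] := sqint_complete (fun n => sqint_comb_f (s n)) dX.
exists X; split => // eps eps0.
have [n _ /(_ n (leqnn n)) neps] : \forall n \near \oo, 8^-1 ^+ n < eps.
  have c : (8^-1 : R) ^+ n @[n --> \oo] --> 0 by apply: cvg_expr; rewrite ger0_norm; lra.
  exact: cvgr_lt c _ eps0.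
exists (s n); split; last exact: le_lt_trans (XE n) neps.
by have := us n; have := @exprn_ge0 _ n (8^-1 : R) _; move=> /(_ ltac:(lra)); lra.
Qed.

Lemma extends_comb s : extends (comb s e) (comb s f).
Proof.
split => // eps eps0; exists s; split.
  rewrite /sqnorm; under eq_Rintegral do rewrite subrr expr0n.
  by rewrite /Rintegral integral0.
rewrite /sqnorm; under eq_Rintegral do rewrite subrr expr0n.
by rewrite /Rintegral integral0.
Qed.

(** One list must approximate on both sides, so the estimate [main] is proved for an arbitrary
    measure and applied to [mu] and to [P]. *)
Lemma extends_lin k u1 X1 u2 X2 : extends u1 X1 -> extends u2 X2 ->
  extends (fun t => k * u1 t + u2 t) (fun t => k * X1 t + X2 t).
Proof.
move=> [su1 sX1 a1] [su2 sX2 a2]; split.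
- by apply: sqintD => //; exact: sqintZ.
- by apply: sqintD => //; exact: sqintZ.
(* The squared error is below 2 (k^2 d + d) = eps / 2. *)
move=> eps eps0; pose d := eps / (4 * (k ^+ 2 + 1)).
have k0 : 0 < 4 * (k ^+ 2 + 1) by have := sqr_ge0 k; lra.
have d0 : 0 < d by rewrite divr_gt0.
have [s1 [us1 Xs1]] := a1 _ d0; have [s2 [us2 Xs2]] := a2 _ d0.
have dE : d * (4 * (k ^+ 2 + 1)) = eps by rewrite /d divfK// gt_eqF.
have main dA (A : measurableType dA) (m : {measure set A -> \bar R}) (v1 v2 w1 w2 : A -> R) :
    sqint m v1 -> sqint m v2 -> sqint m w1 -> sqint m w2 ->
    sqnorm m (fun t => v1 t - w1 t) < d -> sqnorm m (fun t => v2 t - w2 t) < d ->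
    sqnorm m (fun t => k * v1 t + v2 t - (k * w1 t + w2 t)) < eps.
  move=> sv1 sv2 sw1 sw2 d1 d2.
  rewrite (_ : (fun _ => _) = fun t => k * (v1 t - w1 t) + (v2 t - w2 t)); last first.
    by apply/funext => t; ring.
  have s1' := sqintB sv1 sw1; have s2' := sqintB sv2 sw2.
  apply: (le_lt_trans (le_sqnormD (sqintZ k s1') s2')).
  rewrite sqnormZ//; have := sqr_ge0 k; move: (k ^+ 2) dE d1 d2 => K dE d1 d2 K0.
  have := ler_wpM2l K0 (ltW d1); nra.
exists (comb_scale k s1 ++ s2).
rewrite (_ : comb _ e = fun t => k * comb s1 e t + comb s2 e t); last first.
  by apply/funext => t; rewrite comb_cat comb_scaleE.
rewrite (_ : comb _ f = fun t => k * comb s1 f t + comb s2 f t); last first.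
  by apply/funext => t; rewrite comb_cat comb_scaleE.
by split; apply: main.
Qed.

Lemma extends_combs (J : Type) (u : J -> S -> R) (X : J -> T -> R) s :
  (forall j, extends (u j) (X j)) -> extends (comb s u) (comb s X).
Proof.
move=> uX; elim: s => [|p s IH].
  by rewrite !comb_nil -[X in extends X _](comb_nil e) -[X in extends _ X](comb_nil f);
    exact: extends_comb.
rewrite (_ : comb _ u = fun t => p.1 * u p.2 t + comb s u t); last first.
  by apply/funext => t; rewrite comb_cons.
rewrite (_ : comb _ X = fun t => p.1 * X p.2 t + comb s X t); last first.
  by apply/funext => t; rewrite comb_cons.
exact: extends_lin.
Qed.

(** The same lists make the variables converge to X and their variances to the squared norm of u. *)
Lemma extends_cgauss u X : extends u X -> cgauss P X (sqnorm mu u).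
Proof.
move=> [su sX a].
have h0 n : 0 < shrink R n ^+ 2 by rewrite exprn_gt0// shrink_gt0.
have [s us] := choice (fun n => a _ (h0 n)).
apply: (@cgauss_limit _ _ _ P X (fun n => comb (s n) f)
  (fun n => sqnorm mu (comb (s n) e))) => //.
  by move=> n; rewrite ltW//; case: (us n).
apply: sqnorm_cvg => // n.
by rewrite ltW//; case: (us n).
Qed.

End gaussian_extension.

(** * Density of trigonometric polynomials *)

Section closure.
Context (R : realType) (I : Type) dS (S : measurableType dS) (mu : {measure set S -> \bar R}).
Variable e : I -> S -> R.
Hypothesis sqint_e : forall i, sqint mu (e i).

Lemma in_closure_comb s : in_closure mu e (comb s e).
Proof.
split=> [|eps eps0]; first exact: comb_sqint.
exists s; rewrite /sqnorm; under eq_Rintegral do rewrite subrr expr0n.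
by rewrite /Rintegral integral0.
Qed.

Lemma in_closure_lin k u1 u2 : in_closure mu e u1 -> in_closure mu e u2 ->
  in_closure mu e (fun t => k * u1 t + u2 t).
Proof.
move=> [su1 a1] [su2 a2]; split; first by apply: sqintD => //; exact: sqintZ.
move=> eps eps0; pose d := eps / (4 * (k ^+ 2 + 1)).
have k0 : 0 < 4 * (k ^+ 2 + 1) by have := sqr_ge0 k; lra.
have d0 : 0 < d by rewrite divr_gt0.
have [s1 d1] := a1 _ d0; have [s2 d2] := a2 _ d0.
have dE : d * (4 * (k ^+ 2 + 1)) = eps by rewrite /d divfK// gt_eqF.
exists (comb_scale k s1 ++ s2).
rewrite (_ : (fun _ => _) = fun t =>
    k * (u1 t - comb s1 e t) + (u2 t - comb s2 e t)); last first.
  by apply/funext => t; rewrite comb_cat comb_scaleE; ring.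
have s1' := sqintB su1 (comb_sqint s1 sqint_e).
have s2' := sqintB su2 (comb_sqint s2 sqint_e).
apply: (le_lt_trans (le_sqnormD (sqintZ k s1') s2')).
rewrite sqnormZ//; have := sqr_ge0 k; move: (k ^+ 2) dE d1 d2 => K dE d1 d2 K0.
have := ler_wpM2l K0 (ltW d1); nra.
Qed.

Lemma in_closureZ k u : in_closure mu e u -> in_closure mu e (fun t => k * u t).
Proof.
move=> cu; have := in_closure_lin k cu (in_closure_comb [::]).
by rewrite comb_nil; under [X in in_closure _ _ X -> _]eq_fun do rewrite addr0.
Qed.

Lemma in_closure_sum J (s : seq J) (u : J -> S -> R) :
  (forall j, in_closure mu e (u j)) -> in_closure mu e (fun t => \sum_(j <- s) u j t).
Proof.
move=> cu; elim: s => [|j s IH].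
  by under [X in in_closure _ _ X]eq_fun do rewrite big_nil; rewrite -(comb_nil e);
    exact: in_closure_comb.
under [X in in_closure _ _ X]eq_fun do rewrite big_cons -[u j _]mul1r.
exact: in_closure_lin.
Qed.

Lemma in_closure_lim (u_ : nat -> S -> R) u : (forall n, in_closure mu e (u_ n)) ->
  sqint mu u -> sqnorm mu (fun t => u t - u_ n t) @[n --> \oo] --> 0 ->
  in_closure mu e u.
Proof.
move=> cu su uu; split => // eps eps0.
have e4 : 0 < eps / 4 by rewrite divr_gt0.
have [n _ /(_ n (leqnn n)) un] : \forall n \near \oo, sqnorm mu (fun t => u t - u_ n t) < eps / 4.
  exact: cvgr_lt uu _ e4.
have [sun /(_ _ e4)[s us]] := cu n; exists s.
apply: (le_lt_trans (le_sqnormBB su sun (comb_sqint s sqint_e))).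
by lra.
Qed.

End closure.

(* The random phase exp(2 i pi x.t) is replaced by the real function cos + sin:
   against an even density the cross terms sin(2 pi (x + y).t) integrate to 0,
   so that cas x and cas y have inner product K(x - y). *)
Definition cas (R : realType) n (x t : 'rV[R]_n) : R :=
  cos (2 * pi * dotv x t) + sin (2 * pi * dotv x t).

Section density.
Context (R : realType) (n : nat).
Implicit Types (x y : 'rV[R]_n).

Definition coordinate (i : 'I_n) (t : 'rV[R]_n) : R := t ord0 i.

Lemma dotvN x t : dotv (- x) t = - dotv x t.
Proof. by rewrite /dotv -sumrN; apply: eq_bigr => i _; rewrite mxE mulNr. Qed.

Lemma dotvD x y t : dotv (x + y) t = dotv x t + dotv y t.
Proof. by rewrite /dotv -big_split; apply: eq_bigr => i _; rewrite mxE mulrDl. Qed.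

Lemma measurable_dotv x : measurable_fun setT (dotv x).
Proof.
apply: measurable_sum => i; apply: measurable_funM => //; exact: measurable_rV_coor.
Qed.

Lemma measurable_2pi_dotv x : measurable_fun setT (fun t => 2 * pi * dotv x t).
Proof. by apply: measurable_funM => //; exact: measurable_dotv. Qed.

Lemma measurable_cas x : measurable_fun setT (cas x).
Proof.
apply: measurable_funD; [apply: measurable_cos|apply: measurable_sin];
  exact: measurable_2pi_dotv.
Qed.

Lemma cas_le2 x t : `|cas x t| <= 2.
Proof.
rewrite (le_trans (ler_normD _ _))// (_ : 2 = 1 + 1 :> R)//.
by rewrite lerD// ler_norml ?cos_geN1 ?cos_le1 ?sin_geN1 ?sin_le1.
Qed.

Lemma measurable_sqrt d (T : measurableType d) (f : T -> R) :
  (forall t, 0 <= f t) -> measurable_fun setT f -> measurable_fun setT (fun t => Num.sqrt (f t)).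
Proof.
move=> f0 mf; rewrite (_ : (fun _ => _) = fun t => f t `^ 2^-1).
  exact: (measurableT_comp (measurable_powR _)).
by apply/funext => t; rewrite powR12_sqrt.
Qed.

Lemma measurable_sqrtV d (T : measurableType d) (f : T -> R) :
  (forall t, 0 <= f t) -> measurable_fun setT f ->
  measurable_fun setT (fun t => (Num.sqrt (f t))^-1).
Proof.
move=> f0 mf; rewrite (_ : (fun _ => _) = fun t => f t `^ (- 2^-1)).
  exact: (measurableT_comp (measurable_powR _)).
by apply/funext => t; rewrite powRN powR12_sqrt.
Qed.

Variables (mu : {measure set 'rV[R]_n -> \bar R}) (rho : 'rV[R]_n -> R).
Hypotheses (rho0 : forall t, 0 <= rho t) (irho : rintegrable mu rho).

Definition weighted_cas x (t : 'rV[R]_n) := cas x t * Num.sqrt (rho t).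

Let mrho : measurable_fun setT rho. Proof. exact: rintegrable_measurable irho. Qed.

Let msqrt : measurable_fun setT (fun t => Num.sqrt (rho t)).
Proof. exact: measurable_sqrt. Qed.

Lemma sqint_bounded_sqrt (h : 'rV[R]_n -> R) M : measurable_fun setT h ->
  (forall t, `|h t| <= M) -> sqint mu (fun t => h t * Num.sqrt (rho t)).
Proof.
move=> mh hM; have mhr : measurable_fun setT (fun t => h t * Num.sqrt (rho t)).
  exact: measurable_funM.
split => //; apply: (rintegrable_le _ _ (rintegrableZ (M ^+ 2) irho)).
  exact: measurable_funX.
move=> t; rewrite ger0_norm ?sqr_ge0// exprMn sqr_sqrtr// ler_wpM2r//.
by rewrite -(@real_normK _ (h t)) ?num_real// lerXn2r ?nnegrE// (le_trans _ (hM t)).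
Qed.

Lemma sqint_weighted_cas x : sqint mu (weighted_cas x).
Proof. exact: sqint_bounded_sqrt (measurable_cas x) (cas_le2 x). Qed.

Local Notation clos := (in_closure mu weighted_cas).

(** Cosine and sine are the even and odd parts of [cas], hence half the sum and half the difference
    of its values at x and -x. The limit rule becomes an L2 limit because sqrt(rho) is
    square-integrable. *)
Lemma in_closure_trig h : trig_closure coordinate h ->
  clos (fun t => h t * Num.sqrt (rho t)).
Proof.
have lin := in_closure_lin sqint_weighted_cas.
have lincas c : exists x, forall t, linform coordinate c t = 2 * pi * dotv x t.
  exists (\row_i (c i / (2 * pi))) => t; rewrite /dotv mulr_sumr.
  have E (p a b : R) : p != 0 -> a * b = 2 * p * (a / (2 * p) * b) by move=> ?; field.
  by apply: eq_bigr => i _; rewrite mxE -E// gt_eqF// pi_gt0.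
have cl k x : clos (comb [:: (2^-1, x); (k, - x)] weighted_cas).
  by apply: in_closure_comb; exact: sqint_weighted_cas.
elim=> [c|c|{}f g tf cf tg cg|k {}f tf cf|f_ {}f M tf cf fM fc].
- have [x xE] := lincas c; rewrite (_ : (fun _ => _) =
    comb [:: (2^-1, x); (2^-1, - x)] weighted_cas); first exact: cl.
  apply/funext => t; rewrite comb_cons comb1 /weighted_cas /cas /= dotvN mulrN cosN sinN xE.
  by field.
- have [x xE] := lincas c; rewrite (_ : (fun _ => _) =
    comb [:: (2^-1, x); (- 2^-1, - x)] weighted_cas); first exact: cl.
  apply/funext => t; rewrite comb_cons comb1 /weighted_cas /cas /= dotvN mulrN cosN sinN xE.
  by field.
- under [X in clos X]eq_fun do rewrite mulrDl -[f _ * _]mul1r; exact: lin.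
- by under [X in clos X]eq_fun do rewrite -mulrA; apply: in_closureZ => //;
    exact: sqint_weighted_cas.
- have mf j : measurable_fun setT (f_ j).
    exact: (@trig_measurable _ _ _ coordinate _ _ idfun (f_ j) (@measurable_rV_coor R n)).
  have sM : sqint mu (fun t => M * Num.sqrt (rho t)).
    by apply: (@sqint_bounded_sqrt (fun=> M) `|M|) => // t; exact: measurable_cst.
  have [||||sf c] := @sqnorm_dominated_cvg _ _ _ mu
    (fun j t => f_ j t * Num.sqrt (rho t)) (fun t => f t * Num.sqrt (rho t))
    (fun t => M * Num.sqrt (rho t)).
  + by move=> j; exact: measurable_funM.
  + by move=> t; apply: cvgM; [exact: fc|exact: cvg_cst].
  + exact: sM.
  + by move=> j t; rewrite !normrM ler_wpM2r// (le_trans (fM j t))// ler_norm.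
  exact: (in_closure_lim sqint_weighted_cas cf sf c).
Qed.

Lemma in_closure_indic (A : set 'rV[R]_n) : measurable A ->
  clos (fun t => \1_A t * Num.sqrt (rho t)).
Proof. by move=> mA; apply: in_closure_trig; exact: trig_indic. Qed.

Lemma in_closure_ge0 (h : 'rV[R]_n -> R) : measurable_fun setT h -> (forall t, 0 <= h t) ->
  sqint mu (fun t => h t * Num.sqrt (rho t)) ->
  clos (fun t => h t * Num.sqrt (rho t)).
Proof.
move=> mh h0 sh.
have meh : measurable_fun setT (EFin \o h) by exact/measurable_EFinP.
have h0' t : setT t -> (0 <= (EFin \o h) t)%E by rewrite lee_fin.
pose g := nnsfun_approx measurableT meh.
have gc t : g j t @[j --> \oo] --> h t.
  have := cvg_nnsfun_approx measurableT meh h0' I.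
  by move=> /(_ t) /fine_cvg.
have gh j t : `|g j t * Num.sqrt (rho t)| <= `|h t * Num.sqrt (rho t)|.
  rewrite !normrM ler_wpM2r// ger0_norm// (ger0_norm (h0 t)).
  by rewrite -lee_fin /g nnsfun_approxE; exact: le_approx.
have [||||_ c] := @sqnorm_dominated_cvg _ _ _ mu
    (fun j t => g j t * Num.sqrt (rho t)) (fun t => h t * Num.sqrt (rho t))
    (fun t => h t * Num.sqrt (rho t)).
- by move=> j; apply: measurable_funM => //; exact: measurable_funPT.
- by move=> t; apply: cvgM; [exact: gc|exact: cvg_cst].
- exact: sh.
- exact: gh.
apply: (in_closure_lim sqint_weighted_cas _ sh c) => j.
under [X in clos X]eq_fun do rewrite fimfunEord mulr_suml.
apply: in_closure_sum; first exact: sqint_weighted_cas.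
move=> i; under [X in clos X]eq_fun do rewrite -mulrA.
apply: in_closureZ; first exact: sqint_weighted_cas.
apply: in_closure_indic; rewrite -[X in measurable X]setTI.
exact: measurable_funPT.
Qed.

(** v = (v / sqrt rho) sqrt rho, also where rho = 0: there the quotient is 0 and v vanishes by
    hypothesis. Positive and negative parts reduce to [in_closure_ge0]. *)
Lemma in_closure_absolutely_continuous (v : 'rV[R]_n -> R) : sqint mu v ->
  (forall t, rho t = 0 -> v t = 0) -> clos v.
Proof.
move=> sv v0; have [mv _] := sv.
pose r t := Num.sqrt (rho t).
have r0 t : 0 <= r t by exact: sqrtr_ge0.
have rV t (a : R) : (rho t = 0 -> a = 0) -> a / r t * r t = a.
  have [rt a0|rt _] := eqVneq (rho t) 0; first by rewrite a0// !mul0r.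
  by rewrite divfK// gt_eqF// sqrtr_gt0 lt_neqAle eq_sym rt rho0.
have part (w : 'rV[R]_n -> R) : measurable_fun setT w -> (forall t, 0 <= w t) ->
    (forall t, w t <= `|v t|) -> clos w.
  move=> mw w0 wv.
  have wr : (fun t => w t / r t * r t) = w.
    apply/funext => t; apply: rV => /v0 vt; apply/eqP; rewrite eq_le w0 andbT.
    by rewrite (le_trans (wv t))// vt normr0.
  have sw : sqint mu w by apply: sqint_le sv => // t; rewrite (ger0_norm (w0 t)).
  rewrite -wr; apply: in_closure_ge0; rewrite ?wr//.
    by apply: measurable_funM => //; exact: measurable_sqrtV.
  by move=> t; rewrite divr_ge0.
have cp : clos (fun t => Num.max (v t) 0).
  apply: part; first exact: measurable_maxr.
    by move=> t; rewrite le_max lexx orbT.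
  by move=> t; rewrite ge_max ler_norm normr_ge0.
have cn : clos (fun t => Num.max (- v t) 0).
  apply: part; first by apply: measurable_maxr => //; exact: measurable_funN.
    by move=> t; rewrite le_max lexx orbT.
  by move=> t; rewrite ge_max -normrN ler_norm normr_ge0.
have := in_closure_lin sqint_weighted_cas (-1) cn cp.
congr (in_closure _ _ _); apply/funext => t.
by have [vt|vt] := leP (v t) 0; have [vt'|vt'] := leP (- v t) 0; lra.
Qed.

End density.

(** * Spectral fields *)

Section reflection.
Context (R : realType).

Lemma measurable_oppv n : measurable_fun setT (-%R : 'rV[R]_n -> 'rV[R]_n).
Proof.
apply: measurable_fun_rV => i; under [X in measurable_fun _ X]eq_fun do rewrite mxE.
by apply: measurable_funN; exact: measurable_rV_coor.
Qed.

(** Follows the recursive construction of the measure: the reflected product agrees with the product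
    on rectangles, which determine it. *)
Lemma lebesgue_rV_opp n (A : set 'rV[R]_n) : measurable A ->
  lebesgue_rV n (-%R @^-1` A) = lebesgue_rV n A.
Proof.
elim: n A => [|n IH] A mA.
  congr (_ _); apply/seteqP; split => x /=; by rewrite (thinmx0 (- x)) (thinmx0 x).
have mcons (B : set 'rV[R]_n.+1) : measurable B -> measurable (@cons_rV R n @^-1` B).
  by move=> mB; rewrite -[X in measurable X]setTI; exact: measurable_cons_rV.
pose opp2 (p : measurableTypeR R * 'rV[R]_n) : measurableTypeR R * 'rV[R]_n := (- p.1, - p.2).
have mopp2 : measurable_fun setT opp2.
  apply: measurable_fun_pair.
    exact: (measurableT_comp (@oppr_measurable R setT) measurable_fst).
  exact: (measurableT_comp (@measurable_oppv n) measurable_snd).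
rewrite /= /lebesgue_rV_step /pushforward.
rewrite (_ : @cons_rV R n @^-1` (-%R @^-1` A) = opp2 @^-1` (@cons_rV R n @^-1` A)); last first.
  apply/seteqP; split => p /=; congr A; apply/rowP => i; rewrite !mxE;
    by case: unliftP => [j _|_] /=; rewrite ?mxE.
have mA' := mcons _ mA.
rewrite [RHS](@product_measure_unique _ _ _ _ R (@lebesgue_measure R) (lebesgue_rV n)
  (measure_function_pushforward__canonical__measure_function_Measure
    (lebesgue_measure \x lebesgue_rV n)%E mopp2))//.
move=> A1 A2 mA1 mA2; rewrite /= /pushforward.
rewrite (_ : opp2 @^-1` (A1 `*` A2) = (-%R @^-1` A1) `*` (-%R @^-1` A2))//.
rewrite product_measure1E.
- by rewrite IH// -lebesgue_measureN.
- rewrite -[X in measurable X]setTI; exact: (@oppr_measurable R setT).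
- by rewrite -[X in measurable X]setTI; exact: measurable_oppv.
Qed.

Lemma Rintegral_odd n (f : 'rV[R]_n -> R) : rintegrable (lebesgue_rV n) f ->
  (forall t, f (- t) = - f t) -> \int[lebesgue_rV n]_t f t = 0.
Proof.
move=> fi fN; have mf := rintegrable_measurable fi.
have : \int[lebesgue_rV n]_t f t = \int[lebesgue_rV n]_t f (- t).
  rewrite /Rintegral; congr fine.
  rewrite -[RHS](@integral_pushforward _ _ _ _ _ _ (@measurable_oppv n) (lebesgue_rV n) setT
    (EFin \o f))//.
  - apply: eq_measure_integral => [|mo A mA _]; first exact: measurable_oppv.
    exact: esym (lebesgue_rV_opp mA).
  - exact/measurable_EFinP.
  - rewrite preimage_setT; have := rintegrableZ (-1) fi; congr (integrable _ _ _).
    by apply/funext => t /=; rewrite fN mulN1r.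
under [in RHS]eq_Rintegral do rewrite fN -mulN1r.
by rewrite RintegralZl// mulN1r => ?; lra.
Qed.

End reflection.

(** Variances of combinations depend only on the Gram matrix, so fields are compared through their
    covariances. *)
Lemma sqnorm_comb (R : realType) (I : Type) d (T : measurableType d)
    (mu : {measure set T -> \bar R}) (g : I -> T -> R) (s : seq (R * I)) :
  (forall i, sqint mu (g i)) -> sqnorm mu (comb s g) =
    \sum_(p <- s) \sum_(q <- s) p.1 * q.1 * \int[mu]_t (g p.2 t * g q.2 t).
Proof.
move=> sg; have ig p q := sqintM (sg p) (sg q).
transitivity (\int[mu]_t \sum_(p <- s) \sum_(q <- s) p.1 * q.1 * (g p.2 t * g q.2 t)).
  apply: eq_Rintegral => t _; rewrite expr2 /comb mulr_suml; apply: eq_bigr => p _.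
  by rewrite mulr_sumr; apply: eq_bigr => q _; ring.
rewrite Rintegral_sum => [|p]; last by apply: rintegrable_sum => q; exact: rintegrableZ.
apply: eq_bigr => p _; rewrite Rintegral_sum => [|q]; last exact: rintegrableZ.
by apply: eq_bigr => q _; rewrite RintegralZl//; exact: ig.
Qed.

Section spectral_field.
Context (R : realType) (n : nat).
Notation leb := (@lebesgue_rV R n).

Section covariance.
Variable rho : 'rV[R]_n -> R.
Hypotheses (rho0 : forall t, 0 <= rho t) (rhoN : forall t, rho (- t) = rho t).
Hypothesis irho : rintegrable leb rho.

Lemma rintegrable_trig_rho (h : 'rV[R]_n -> R) : measurable_fun setT h ->
  (forall t, `|h t| <= 1) -> rintegrable leb (fun t => h t * rho t).
Proof.
move=> mh h1; apply: rintegrable_le irho; last first.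
  by move=> t; rewrite normrM (ger0_norm (rho0 t)) ler_piMl.
exact: (measurable_funM mh (rintegrable_measurable irho)).
Qed.

Lemma Rintegral_weighted_cas x y :
  \int[leb]_t (weighted_cas rho x t * weighted_cas rho y t) =
    \int[leb]_t (cos (2 * pi * dotv (x - y) t) * rho t).
Proof.
have ic : rintegrable leb (fun t => cos (2 * pi * dotv (x - y) t) * rho t).
  apply: rintegrable_trig_rho => [|t]; last by rewrite ler_norml cos_geN1 cos_le1.
  by apply: measurable_cos; exact: measurable_2pi_dotv.
have is_ : rintegrable leb (fun t => sin (2 * pi * dotv (x + y) t) * rho t).
  apply: rintegrable_trig_rho => [|t]; last by rewrite ler_norml sin_geN1 sin_le1.
  by apply: measurable_sin; exact: measurable_2pi_dotv.
have s0 : \int[leb]_t (sin (2 * pi * dotv (x + y) t) * rho t) = 0.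
  apply: Rintegral_odd => // t.
  rewrite rhoN (_ : dotv _ (- t) = - dotv (x + y) t) ?mulrN ?sinN ?mulNr//.
  by rewrite /dotv -sumrN; apply: eq_bigr => i _; rewrite !mxE mulrN.
rewrite -[RHS]addr0 -s0 -RintegralD//; apply: eq_Rintegral => t _.
rewrite /weighted_cas mulrACA -expr2 sqr_sqrtr// -mulrDl; congr (_ * _).
rewrite /cas (_ : _ * dotv (x - y) t = 2 * pi * dotv x t - 2 * pi * dotv y t); last first.
  by rewrite dotvD dotvN mulrBr.
rewrite (_ : _ * dotv (x + y) t = 2 * pi * dotv x t + 2 * pi * dotv y t).
  by rewrite cosB sinD; ring.
by rewrite dotvD mulrDr.
Qed.

(** Fixes all finite-dimensional laws at once; the real family [weighted_cas] has the Gram matrix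
    K(x - y). *)
Definition spectral_field d (T : measurableType d) (P : probability T R)
    (g : 'rV[R]_n -> T -> R) :=
  forall s, cgauss P (comb s g) (sqnorm leb (comb s (weighted_cas rho))).

Section moments.
Context d (T : measurableType d) (P : probability T R) (g : 'rV[R]_n -> T -> R).
Hypothesis sg : spectral_field P g.

Lemma spectral_cgauss x : cgauss P (g x) (sqnorm leb (weighted_cas rho x)).
Proof.
have E (S : Type) (e : 'rV[R]_n -> S -> R) : e x = comb [:: (1, x)] e.
  by apply/funext => t; rewrite comb1 mul1r.
by rewrite (E _ g) (E _ (weighted_cas rho)); exact: sg.
Qed.

Lemma spectral_sqint x : sqint P (g x).
Proof. exact: cgauss_sqint (sqnorm_ge0 _ _) (spectral_cgauss x). Qed.

(** Polarization from the variances of g x + g y, g x and g y. *)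
Lemma spectral_covariance x y : \int[P]_w (g x w * g y w) =
  \int[leb]_t (cos (2 * pi * dotv (x - y) t) * rho t).
Proof.
rewrite -Rintegral_weighted_cas.
have swc := sqint_weighted_cas rho0 irho.
have E := esym (cgauss_sqnorm (sqnorm_ge0 _ _) (sg [:: (1, x); (1, y)])).
have Ex := esym (cgauss_sqnorm (sqnorm_ge0 _ _) (sg [:: (1, x)])).
have Ey := esym (cgauss_sqnorm (sqnorm_ge0 _ _) (sg [:: (1, y)])).
move: E Ex Ey; rewrite !(sqnorm_comb _ spectral_sqint) !(sqnorm_comb _ swc).
rewrite !(big_cons, big_nil) /= !mulr1 !mul1r !addr0 => + Ex Ey.
rewrite -Ex -Ey => E.
have C1 : \int[P]_t (g y t * g x t) = \int[P]_t (g x t * g y t).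
  by apply: eq_Rintegral => t _; rewrite mulrC.
have C2 : \int[leb]_t (weighted_cas rho y t * weighted_cas rho x t) =
    \int[leb]_t (weighted_cas rho x t * weighted_cas rho y t).
  by apply: eq_Rintegral => t _; rewrite mulrC.
by move: E; rewrite C1 C2; lra.
Qed.

End moments.

Section same_law.
Context d1 (T1 : measurableType d1) (P1 : probability T1 R) (g1 : 'rV[R]_n -> {RV P1 >-> R}).
Context d2 (T2 : measurableType d2) (P2 : probability T2 R) (g2 : 'rV[R]_n -> {RV P2 >-> R}).

(** Cramer-Wold: the characteristic function of a vector at c is that of one combination at
    frequency 1, whence the factor 1 in [linE]. *)
Lemma spectral_same_law : spectral_field P1 g1 -> spectral_field P2 g2 -> same_law g1 g2.
Proof.
move=> sg1 sg2 m x B mB.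
pose phi (i : 'I_m) (z : m.-tuple R) := tnth z i.
have phiE d (T : measurableType d) (P : probability T R) (g : 'rV[R]_n -> {RV P >-> R}) i :
    phi i \o (fun w => [tuple g (x j) w | j < m]) = g (x i).
  by apply/funext => w; rewrite /phi /= tnth_mktuple.
have linE d (T : measurableType d) (P : probability T R) (g : 'rV[R]_n -> {RV P >-> R}) c w :
    linform phi c [tuple g (x j) w | j < m] =
      1 * comb [seq (c j, x j) | j <- index_enum 'I_m] g w.
  rewrite mul1r comb_ord; apply: eq_bigr => i _; congr (_ * _).
  by rewrite /phi tnth_mktuple.
apply: (@law_unique R (m.-tuple R) m phi _ _ P1 _ _ _ P2 _ _ _ _ _ B mB).
- by move=> i; rewrite phiE; exact: measurable_funPT.
- by move=> i; rewrite phiE; exact: measurable_funPT.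
- move=> c; have [_ c1 _] := sg1 [seq (c j, x j) | j <- index_enum 'I_m].
  have [_ c2 _] := sg2 [seq (c j, x j) | j <- index_enum 'I_m].
  by under eq_Rintegral do rewrite linE; rewrite c1;
    under [in RHS]eq_Rintegral do rewrite linE; rewrite c2.
- move=> c; have [_ _ c1] := sg1 [seq (c j, x j) | j <- index_enum 'I_m].
  have [_ _ c2] := sg2 [seq (c j, x j) | j <- index_enum 'I_m].
  by under eq_Rintegral do rewrite linE; rewrite c1;
    under [in RHS]eq_Rintegral do rewrite linE; rewrite c2.
Qed.

End same_law.

(** The Gram entries depend on differences of points only. *)
Lemma spectral_shift d (T : measurableType d) (P : probability T R)
    (g : 'rV[R]_n -> T -> R) h :
  spectral_field P g -> spectral_field P (fun x => g (x + h)).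
Proof.
move=> sg s; have := sg [seq (p.1, p.2 + h) | p <- s].
have -> : comb [seq (p.1, p.2 + h) | p <- s] g = comb s (fun x => g (x + h)).
  by apply/funext => t; rewrite /comb big_map.
suff -> : sqnorm leb (comb [seq (p.1, p.2 + h) | p <- s] (weighted_cas rho)) =
    sqnorm leb (comb s (weighted_cas rho)) by [].
have swc := sqint_weighted_cas rho0 irho.
rewrite !(sqnorm_comb _ swc) big_map; apply: eq_bigr => p _.
rewrite big_map; apply: eq_bigr => q _ /=.
by rewrite !Rintegral_weighted_cas opprD addrACA subrr addr0.
Qed.

Section gaussian.
Context d (T : measurableType d) (P : probability T R) (g : 'rV[R]_n -> {RV P >-> R}).
Hypothesis sg : spectral_field P g.

Lemma spectral_gaussian : centered_stationary_gaussian g.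
Proof.
split.
- move=> m c x; have := sg [seq (c j, x j) | j <- index_enum 'I_m].
  move=> /(cgauss_gaussian (sqnorm_ge0 _ _)); congr (gaussian_rv _ _).
  by apply/funext => w; rewrite comb_ord.
- move=> x; have gx := spectral_cgauss sg x.
  have ix := rintegrable_sqint (cgauss_sqint (sqnorm_ge0 _ _) gx).
  by rewrite unlock -EFin_Rintegral// (cgauss_mean (sqnorm_ge0 _ _) gx).
- move=> h; apply: spectral_same_law => //.
  exact: (@spectral_shift _ _ P (fun x => g x) h sg).
Qed.

Lemma spectral_covariance_kernel x y : covariance_kernel g x y =
  \int[leb]_t (cos (2 * pi * dotv (x - y) t) * rho t).
Proof. by rewrite -(spectral_covariance sg) /covariance_kernel unlock. Qed.

End gaussian.

Section of_density.
Context d (T : measurableType d) (P : probability T R) (f : 'rV[R]_n -> {RV P >-> R}).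
Hypotheses (f_csg : centered_stationary_gaussian f) (f_rho : spectral_density f rho).

Let covE x y : \int[P]_w (f x w * f y w) =
  \int[leb]_t (cos (2 * pi * dotv (x - y) t) * rho t).
Proof.
(* The kernel is taken at base point y and lag x - y; the real part of the complex identity is all
   that is kept. *)
have [_ _ _ /(_ (x - y) y)] := f_rho.
rewrite addrC subrK /covariance_kernel /Cintegral => -[+ _].
rewrite unlock => E; transitivity (fine (\int[P]_w ((f y \* f x) w)%:E)%E).
  by congr fine; apply: eq_integral => w _ /=; rewrite mulrC.
rewrite E; apply: eq_Rintegral => t _ /=.
by rewrite mulr0 subr0.
Qed.

(** Each combination is Gaussian by hypothesis and centered, so only its variance has to be found,
    and that is read off the covariances. *)
Lemma density_spectral : spectral_field P f.
Proof.
have [gf cf _] := f_csg; move=> s.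
have mf x : measurable_fun setT (f x) by exact: measurable_funPT.
have fx x : exists2 v, 0 <= v & cgauss P (f x) v.
  apply: gaussian_cgauss => //; have := gf 1%N (fun=> 1) (fun=> x).
  by congr (gaussian_rv _ _); apply/funext => w; rewrite big_ord1 mul1r.
have sf x : sqint P (f x) by have [v v0 /(cgauss_sqint v0)] := fx x.
have gs : gaussian_rv P (comb s f).
  have := gf (size s) (fun j => (nth (0, 0) s j).1) (fun j => (nth (0, 0) s j).2).
  congr (gaussian_rv _ _); apply/funext => w.
  by rewrite /comb (big_nth (0, 0)) big_mkord.
have [ms is_] := comb_sqint s sf.
have Es : ('E_P[comb s f] = 0)%E.
  rewrite unlock -EFin_Rintegral; last exact: rintegrable_sqint (conj ms is_).
  rewrite Rintegral_sum ?big1// => [p _|p].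
    have [v v0 /(cgauss_mean v0) m0] := fx p.2.
    by rewrite RintegralZl ?m0 ?mulr0//; exact: rintegrable_sqint.
  by apply: rintegrableZ; exact: rintegrable_sqint.
have [v v0 gv] := gaussian_cgauss ms gs Es.
suff <- : v = sqnorm leb (comb s (weighted_cas rho)) by [].
have swc := sqint_weighted_cas rho0 irho.
rewrite -(cgauss_sqnorm v0 gv) !(sqnorm_comb _ sf) (sqnorm_comb _ swc).
apply: eq_bigr => p _; apply: eq_bigr => q _; congr (_ * _).
by rewrite covE Rintegral_weighted_cas.
Qed.

End of_density.

End covariance.
End spectral_field.

(** * Mixed partial derivatives of a stationary covariance *)

Section list_monomial.
Context (R : realType) (n : nat).

(** Indexed by lists to match [partials], which differentiates along a list of directions; products
    of monomials become concatenations. *)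
Definition lmonomial (s : seq 'I_n) (t : 'rV[R]_n) : R := \prod_(i <- s) t ord0 i.

Lemma lmonomial_count s t : lmonomial s t = monomial (fun i => count_mem i s) t.
Proof.
rewrite /lmonomial /monomial; elim: s => [|j s IH].
  by rewrite big_nil big1.
rewrite big_cons IH /=; under [in RHS]eq_bigr do rewrite exprD.
rewrite big_split /=; congr (_ * _); rewrite (bigD1 j)//= eqxx expr1 big1 ?mulr1// => i ij.
by rewrite eq_sym (negbTE ij).
Qed.

Lemma mdegree_count (s : seq 'I_n) : mdegree (fun i => count_mem i s) = size s.
Proof.
rewrite /mdegree; elim: s => [|j s IH] /=; first by rewrite big1.
rewrite big_split /= IH -add1n; congr (_ + _)%N; rewrite (bigD1 j)//= eqxx big1// => i ij.
by rewrite eq_sym (negbTE ij).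
Qed.

Lemma size_directions (a : 'I_n -> nat) : size (directions a) = mdegree a.
Proof.
rewrite /directions size_flatten /shape -map_comp sumnE big_map big_enum.
by apply: eq_bigr => i _; rewrite /= size_nseq.
Qed.

Lemma lmonomial_directions (a : 'I_n -> nat) t : lmonomial (directions a) t = monomial a t.
Proof.
rewrite /lmonomial /directions big_flatten big_map big_enum.
by apply: eq_bigr => i _; rewrite big_nseq -Monoid.iteropE.
Qed.

Lemma measurable_lmonomial s : measurable_fun setT (lmonomial s).
Proof.
elim: s => [|i s IH].
  by rewrite (_ : lmonomial [::] = fun=> 1)//; apply/funext => t; rewrite /lmonomial big_nil.
rewrite (_ : lmonomial _ = fun t => t ord0 i * lmonomial s t).
  by apply: measurable_funM => //; exact: measurable_rV_coor.
by apply/funext => t; rewrite /lmonomial big_cons.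
Qed.

End list_monomial.

Lemma dotv_deltaD (R : realType) n (e h : R) (i : 'I_n) (x z t : 'rV[R]_n) :
  dotv (e *: (h *: delta_mx ord0 i + x) + z) t = dotv (e *: x + z) t + h * (e * t ord0 i).
Proof.
rewrite /dotv [in RHS](bigD1 i)//= [in LHS](bigD1 i)//= !mxE !eqxx.
under eq_bigr => j ji do rewrite !mxE (negbTE ji) andbF mulr0 add0r.
under [in RHS]eq_bigr => j ji do rewrite !mxE.
by rewrite /=; ring.
Qed.

Lemma cos_natpi (R : realType) m : cos (m%:R * pi) = (-1) ^+ m :> R.
Proof.
elim: m => [|m IH]; first by rewrite mul0r cos0 expr0.
by rewrite -natr1 mulrDl mul1r cosDpi IH exprS mulN1r.
Qed.

Section derivatives.
Context (R : realType) (n : nat).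
Notation leb := (@lebesgue_rV R n).

Section wave.
Variables (e : R) (z : 'rV[R]_n).

(* Differentiating a cosine shifts its phase by [pi / 2]. *)
Definition wave (p : R) (G : 'rV[R]_n -> R) (x : 'rV[R]_n) : R :=
  \int[leb]_t (cos (2 * pi * dotv (e *: x + z) t + p) * G t).

Lemma wave_partial p G i x : rintegrable leb G ->
  rintegrable leb (fun t => t ord0 i * G t) ->
  derivable (wave p G) x (delta_mx ord0 i) /\
  partial i (wave p G) x = wave (p + pi / 2) (fun t => e * (2 * pi) * t ord0 i * G t) x.
Proof.
move=> iG itG.
have ibG : rintegrable leb (fun t => e * (2 * pi) * t ord0 i * G t).
  by under [X in rintegrable _ X]eq_fun do rewrite -mulrA; exact: rintegrableZ.
have ma : measurable_fun setT (fun t => 2 * pi * dotv (e *: x + z) t + p).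
  by apply: measurable_funD => //; exact: measurable_2pi_dotv.
have mb : measurable_fun setT (fun t : 'rV[R]_n => e * (2 * pi) * t ord0 i).
  by apply: measurable_funM => //; exact: measurable_rV_coor.
have [is_ c] := Rintegral_cos_derive ma mb iG ibG.
have {}c : h^-1 *: (((wave p G) \o shift x) (h *: delta_mx ord0 i) - wave p G x)
    @[h --> 0^'] --> wave (p + pi / 2) (fun t => e * (2 * pi) * t ord0 i * G t) x.
  rewrite [X in _ --> X](_ : _ = - \int[leb]_t (e * (2 * pi) * t ord0 i *
      sin (2 * pi * dotv (e *: x + z) t + p) * G t)); last first.
    rewrite -[RHS]mulN1r -RintegralZl//; apply: eq_Rintegral => t _.
    by rewrite addrA cosDpihalf; ring.
  rewrite (_ : (fun h => _) = fun h => h^-1 * (\int[leb]_t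
      (cos (2 * pi * dotv (e *: x + z) t + p + h * (e * (2 * pi) * t ord0 i)) * G t) -
      \int[leb]_t (cos (2 * pi * dotv (e *: x + z) t + p) * G t)))//.
  apply/funext => h; congr (_ * (_ - _)); apply: eq_Rintegral => t _ /=.
  by rewrite dotv_deltaD; congr (cos _ * _); ring.
by split; [apply/cvg_ex; eexists; exact: c|exact/cvg_lim].
Qed.

(** The parameters e and z let one lemma treat both arguments of K(x - y): e = -1, z = x for
    derivatives in y, and e = 1, z = -y for derivatives in x. *)
Lemma wave_partials (s : seq 'I_n) p G :
  (forall s', (size s' <= size s)%N -> rintegrable leb (fun t => lmonomial s' t * G t)) ->
  partials_exist s (wave p G) /\
  partials s (wave p G) = wave (p + (size s)%:R * (pi / 2))
    (fun t => (e * (2 * pi)) ^+ size s * (lmonomial s t * G t)).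
Proof.
elim: s => [|i s IH] /= iG.
  split => //; congr wave; first by rewrite mul0r addr0.
  by apply/funext => t; rewrite /lmonomial big_nil expr0 !mul1r.
have [|ex ->] := IH; first by move=> s' ss'; apply: iG; exact: leqW.
have i1 : rintegrable leb (fun t => (e * (2 * pi)) ^+ size s * (lmonomial s t * G t)).
  by apply: rintegrableZ; exact: iG.
have i2 : rintegrable leb (fun t => t ord0 i *
    ((e * (2 * pi)) ^+ size s * (lmonomial s t * G t))).
  have := rintegrableZ ((e * (2 * pi)) ^+ size s) (iG (i :: s) (leqnn _)).
  congr (rintegrable _ _); apply/funext => t; rewrite /lmonomial big_cons; ring.
split; first by split => // x; case: (wave_partial (p + (size s)%:R * (pi / 2)) x i1 i2).
apply/funext => x; case: (wave_partial (p + (size s)%:R * (pi / 2)) x i1 i2) => _ ->.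
congr (wave _ _ _); first by rewrite -natr1; ring.
by apply/funext => t; rewrite exprS /lmonomial big_cons; ring.
Qed.

End wave.

Section mixed.
Variables (rho : 'rV[R]_n -> R) (N : nat).
Hypothesis irho : forall s, (size s <= 2 * N)%N ->
  rintegrable leb (fun t => lmonomial s t * rho t).
Variable K : 'rV[R]_n -> 'rV[R]_n -> R.
Hypothesis KE : forall x y, K x y = \int[leb]_t (cos (2 * pi * dotv (x - y) t) * rho t).
Variable a : 'I_n -> nat.
Hypothesis aN : (mdegree a <= N)%N.

Let s := directions a.
Let m := mdegree a.

Let sm : size s = m. Proof. exact: size_directions. Qed.

Let KyE x : K x = wave (- 1) x 0 rho.
Proof.
apply/funext => y; rewrite KE; apply: eq_Rintegral => t _.
by rewrite addr0 scaleN1r [- y + x]addrC.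
Qed.

Let rho_y t := (- 1 * (2 * pi)) ^+ m * (lmonomial s t * rho t).

Let partials_y x : partials_exist s (K x) /\
  partials s (K x) = wave (- 1) x (0 + m%:R * (pi / 2)) rho_y.
Proof.
rewrite KyE /rho_y -sm; apply: wave_partials => s' ss'; apply: irho.
by rewrite (leq_trans ss')// sm mul2n -addnn (leq_trans aN)// leq_addr.
Qed.

Let partials_xE y : (fun x => partials s (K x) y) =
  wave 1 (- y) (0 + m%:R * (pi / 2)) rho_y.
Proof.
apply/funext => x; have [_ ->] := partials_y x; apply: eq_Rintegral => t _.
by rewrite scale1r scaleN1r [- y + x]addrC.
Qed.

Let partials_x y : partials_exist s (fun x => partials s (K x) y) /\
  partials s (fun x => partials s (K x) y) =
    wave 1 (- y) (0 + m%:R * (pi / 2) + m%:R * (pi / 2))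
      (fun t => (1 * (2 * pi)) ^+ m * (lmonomial s t * rho_y t)).
Proof.
rewrite partials_xE -{4 5}sm; apply: wave_partials.
(* The y-derivatives have already put the factor t^a in the integrand; this is where moments of
   order 2N enter. *)
move=> s' ss'; have : (size (s' ++ s) <= 2 * N)%N.
  rewrite size_cat (leq_trans (leq_add ss' (leqnn _)))// sm addnn -mul2n.
  by rewrite leq_mul2l aN orbT.
move=> /irho /(rintegrableZ ((- 1 * (2 * pi)) ^+ m)); congr (rintegrable _ _).
by apply/funext => t; rewrite /rho_y /lmonomial big_cat /=; ring.
Qed.

Lemma stationary_mixed_partial_exists : mixed_partial_exists a K.
Proof. by split => [x|y]; [case: (partials_y x)|case: (partials_x y)]. Qed.

(** On the diagonal 2m shifts by pi / 2 leave cos(m pi) = (-1)^m, which cancels the sign (-1)^m of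
    the derivatives in y. *)
Lemma stationary_mixed_partial x : mixed_partial a K x x =
  (2 * pi) ^+ (2 * m) * \int[leb]_t (monomial a t ^+ 2 * rho t).
Proof.
rewrite /mixed_partial -/s; have [_ ->] := partials_x x.
rewrite /wave scale1r subrr.
have i2 : rintegrable leb (fun t => monomial a t ^+ 2 * rho t).
  have : (size (s ++ s) <= 2 * N)%N.
    by rewrite size_cat size_directions addnn -mul2n leq_mul2l aN orbT.
  move=> /irho; congr (rintegrable _ _); apply/funext => t.
  by rewrite -lmonomial_directions /lmonomial big_cat /= expr2.
rewrite -RintegralZl//; apply: eq_Rintegral => t _.
have -> : dotv 0 t = 0 :> R by rewrite /dotv big1// => i _; rewrite mxE mul0r.
have -> : 2 * pi * 0 + (0 + m%:R * (pi / 2) + m%:R * (pi / 2)) = m%:R * pi :> R.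
  by rewrite mulr0 !add0r -mulrDr -splitr.
rewrite cos_natpi /rho_y lmonomial_directions mul1r mulN1r.
rewrite [(- (2 * pi)) ^+ m]exprNn mul2n -addnn exprD.
have : (-1) ^+ m * (-1) ^+ m = 1 :> R by rewrite -exprMn mulrNN mulr1 expr1n.
move: ((-1) ^+ m) ((2 * pi) ^+ m) => u v uu.
transitivity (u * u * (v * v * (monomial a t ^+ 2 * rho t))). by ring.
by rewrite uu mul1r.
Qed.

End mixed.

End derivatives.

(** * The coupling *)

Lemma Lnorm2_sqr (R : realType) d (T : measurableType d) (mu : {measure set T -> \bar R})
    (f : T -> R) : rintegrable mu (fun t => f t ^+ 2) ->
  ('N[mu]_2%:E[EFin \o f] ^+ 2 = (\int[mu]_t (f t ^+ 2))%:E)%E.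
Proof.
move=> f2; have : ('N[mu]_2%:E[EFin \o f] `^ 2 = (\int[mu]_t (f t ^+ 2))%:E)%E.
  rewrite poweR_Lnorm// EFin_Rintegral//; apply: eq_integral => t _ /=.
  by rewrite powR_mulrn// real_normK ?num_real.
have := Lnorm_ge0 mu 2%:E (EFin \o f).
case: ('N[mu]_2%:E[EFin \o f])%E => [r|_|//]; last by rewrite poweRyr ?pnatr_eq0.
rewrite lee_fin => r0; rewrite poweR_EFin powR_mulrn// => <-.
Qed.

Lemma max_mdegree_ereal_sup (R : realType) n m (V : ('I_n -> nat) -> \bar R) :
  max_mdegree m V = ereal_sup [set V a | a in [set a | (mdegree a <= m)%N]].
Proof.
apply/eqP; rewrite eq_le; apply/andP; split.
  apply: bigmax_le; first exact: leNye.
  by move=> b bm; apply: ereal_sup_ubound; exists (fun i => b i : nat).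
apply: ge_ereal_sup => _ [a /= am <-].
have ai i : (a i <= m)%N.
  by rewrite (leq_trans _ am)// /mdegree (bigD1 i)//= leq_addr.
pose b : {ffun 'I_n -> 'I_m.+1} := [ffun i => inord (a i)].
have bE : (fun i => b i : nat) = a.
  by apply/funext => i; rewrite ffunE inordK// ltnS.
have := @le_bigmax_cond _ _ _ -oo%E b
  (fun b : {ffun 'I_n -> 'I_m.+1} => (mdegree (fun i => b i) <= m)%N)
  (fun b : {ffun 'I_n -> 'I_m.+1} => V (fun i => b i)).
by rewrite bE; apply.
Qed.

Lemma eq_max_mdegree (R : realType) n m (V W : ('I_n -> nat) -> \bar R) :
  (forall a, (mdegree a <= m)%N -> V a = W a) -> max_mdegree m V = max_mdegree m W.
Proof. by move=> VW; apply: eq_bigr => b bm; exact: VW. Qed.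

(** * Sums of independent Gaussian variables *)

Section independent_sum.
Context (R : realType) d1 (T1 : measurableType d1) (P1 : probability T1 R).
Context d2 (T2 : measurableType d2) (P2 : probability T2 R).

Lemma Rintegral_prodM (F1 : T1 -> R) (F2 : T2 -> R) (M : R) :
  measurable_fun setT F1 -> measurable_fun setT F2 ->
  (forall t, `|F1 t| <= M) -> (forall t, `|F2 t| <= M) ->
  rintegrable (P1 \x P2)%E (fun w => F1 w.1 * F2 w.2) /\
  \int[(P1 \x P2)%E]_w (F1 w.1 * F2 w.2) = \int[P1]_t F1 t * \int[P2]_t F2 t.
Proof.
move=> m1 m2 b1 b2.
have i1 := @rintegrable_bounded _ _ _ P1 _ M m1 b1.
have i2 := @rintegrable_bounded _ _ _ P2 _ M m2 b2.
have i12 : rintegrable (P1 \x P2)%E (fun w => F1 w.1 * F2 w.2).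
  apply: (@rintegrable_bounded _ _ _ (P1 \x P2)%E _ (M * M)).
    apply: measurable_funM; first exact: (measurableT_comp m1 measurable_fst).
    exact: (measurableT_comp m2 measurable_snd).
  by move=> w; rewrite normrM ler_pM.
split => //; rewrite {1}/Rintegral.
have := @integral12_prod_meas1 _ _ _ _ R P1 P2 _ i12.
rewrite /fubini_F => <-.
transitivity (fine (\int[P1]_x (F1 x * \int[P2]_t F2 t)%:E)%E).
  congr fine; apply: eq_integral => x _ /=.
  rewrite -RintegralZl// EFin_Rintegral//.
  exact: rintegrableZ.
rewrite mulrC -[RHS]RintegralZl//; apply: eq_Rintegral => x _.
by rewrite mulrC.
Qed.

(** In the addition formulas, every product that contains a sine integrates to 0. *)
Lemma cgauss_sum Y1 Y2 v1 v2 : cgauss P1 Y1 v1 -> cgauss P2 Y2 v2 ->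
  cgauss (P1 \x P2)%E (fun w => Y1 w.1 + Y2 w.2) (v1 + v2).
Proof.
move=> [m1 c1 s1] [m2 c2 s2].
have mth1 th : measurable_fun setT (fun t => th * Y1 t) by exact: measurable_funM.
have mth2 th : measurable_fun setT (fun t => th * Y2 t) by exact: measurable_funM.
have bc (x : R) : `|cos x| <= 1 by rewrite ler_norml cos_geN1 cos_le1.
have bs (x : R) : `|sin x| <= 1 by rewrite ler_norml sin_geN1 sin_le1.
split => [|th|th].
- apply: measurable_funD; first exact: (measurableT_comp m1 measurable_fst).
  exact: (measurableT_comp m2 measurable_snd).
- have [icc cc] := Rintegral_prodM (measurable_cos (mth1 th)) (measurable_cos (mth2 th))
    (fun t => bc _) (fun t => bc _).
  have [iss ss] := Rintegral_prodM (measurable_sin (mth1 th)) (measurable_sin (mth2 th))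
    (fun t => bs _) (fun t => bs _).
  under eq_Rintegral do rewrite mulrDr cosD.
  rewrite RintegralB// cc ss s1 mul0r subr0 c1 c2 -expRD; congr expR.
  by field.
- have [isc sc] := Rintegral_prodM (measurable_sin (mth1 th)) (measurable_cos (mth2 th))
    (fun t => bs _) (fun t => bc _).
  have [ics cs] := Rintegral_prodM (measurable_cos (mth1 th)) (measurable_sin (mth2 th))
    (fun t => bc _) (fun t => bs _).
  under eq_Rintegral do rewrite mulrDr sinD.
  by rewrite RintegralD// sc cs s1 s2 mul0r mulr0 addr0.
Qed.

End independent_sum.

Section pair.
Context (R : realType) (n : nat).
Notation leb := (@lebesgue_rV R n).
Context d1 (T1 : measurableType d1) (P1 : probability T1 R).
Context d2 (T2 : measurableType d2) (P2 : probability T2 R).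
Variables (e1 e2 : 'rV[R]_n -> 'rV[R]_n -> R).
Variables (f1 : 'rV[R]_n -> T1 -> R) (f2 : 'rV[R]_n -> T2 -> R).
Hypotheses (se1 : forall x, sqint leb (e1 x)) (se2 : forall x, sqint leb (e2 x)).
Hypotheses (gf1 : forall s, cgauss P1 (comb s f1) (sqnorm leb (comb s e1)))
  (gf2 : forall s, cgauss P2 (comb s f2) (sqnorm leb (comb s e2))).

(** [a1] and [a2] are the amplitudes on two independent noises. The pairs for g1, g2 and F are (sqrt
    rho1, 0), (b1, b2) and (b1 - sqrt rho1, b2). *)
Lemma spectral_field_pair (a1 a2 rho : 'rV[R]_n -> R)
    (X1 : 'rV[R]_n -> T1 -> R) (X2 : 'rV[R]_n -> T2 -> R) :
  (forall t, 0 <= rho t) -> (forall t, a1 t ^+ 2 + a2 t ^+ 2 = rho t) ->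
  (forall x, extends leb P1 e1 f1 (fun t => cas x t * a1 t) (X1 x)) ->
  (forall x, extends leb P2 e2 f2 (fun t => cas x t * a2 t) (X2 x)) ->
  spectral_field rho (P1 \x P2)%E (fun x w => X1 x w.1 + X2 x w.2).
Proof.
move=> rho0 a12 h1 h2 s.
have c1 := extends_combs se1 gf1 s h1; have c2 := extends_combs se2 gf2 s h2.
have combM (a : 'rV[R]_n -> R) t : comb s (fun x t => cas x t * a t) t =
    comb s (@cas R n) t * a t.
  by rewrite /comb mulr_suml; apply: eq_bigr => p _; rewrite mulrA.
have -> : comb s (fun x w => X1 x w.1 + X2 x w.2) =
    (fun w => comb s X1 w.1 + comb s X2 w.2).
  by apply/funext => w; rewrite /comb -big_split; apply: eq_bigr => p _; rewrite mulrDr.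
have -> : sqnorm leb (comb s (weighted_cas rho)) =
    sqnorm leb (comb s (fun x t => cas x t * a1 t)) +
    sqnorm leb (comb s (fun x t => cas x t * a2 t)).
  have [[_ i1] _ _] := c1; have [[_ i2] _ _] := c2.
  rewrite /sqnorm -RintegralD//; apply: eq_Rintegral => t _.
  by rewrite !combM !exprMn sqr_sqrtr// -mulrDr a12.
apply: cgauss_sum; first exact: (extends_cgauss se1 gf1 c1).
exact: (extends_cgauss se2 gf2 c2).
Qed.

End pair.

Section coupling_density.
Context (R : realType) (n : nat).
Notation leb := (@lebesgue_rV R n).

Lemma coupling_density_le (a b : R) : 0 <= a -> 0 <= b ->
  (Num.sqrt b - Num.sqrt a) ^+ 2 <= a + b.
Proof.
move=> a0 b0; have := sqr_sqrtr a0; have := sqr_sqrtr b0.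
have := mulr_ge0 (sqrtr_ge0 a) (sqrtr_ge0 b); nra.
Qed.

Variables rho1 rho2 : 'rV[R]_n -> R.
Hypotheses (rho1_ge0 : forall t, 0 <= rho1 t) (rho2_ge0 : forall t, 0 <= rho2 t).

Definition coupling_density t := (Num.sqrt (rho2 t) - Num.sqrt (rho1 t)) ^+ 2.

(** (sqrt b - sqrt a)^2 <= a + b, so the spectral measure of F has every moment that those of f1 and
    f2 have. *)
Lemma rintegrable_coupling_density (h : 'rV[R]_n -> R) : measurable_fun setT h ->
  measurable_fun setT rho1 -> measurable_fun setT rho2 ->
  rintegrable leb (fun t => h t * rho1 t) -> rintegrable leb (fun t => h t * rho2 t) ->
  rintegrable leb (fun t => h t * coupling_density t).
Proof.
move=> mh m1 m2 i1 i2.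
have := rintegrableD (integrable_norm i1) (integrable_norm i2).
apply: rintegrable_le.
  apply: measurable_funM => //; apply: measurable_funX.
  by apply: measurable_funB; exact: measurable_sqrt.
move=> t /=; rewrite !normrM (ger0_norm (rho1_ge0 t)) (ger0_norm (rho2_ge0 t)) -mulrDr.
by rewrite ler_wpM2l// -normrM -expr2 ger0_norm ?sqr_ge0// coupling_density_le.
Qed.

Lemma rintegrable_lmonomial rho m s : finite_moments rho m -> (size s <= m)%N ->
  rintegrable leb (fun t => lmonomial s t * rho t).
Proof.
move=> fm sm; under [X in rintegrable _ X]eq_fun do rewrite lmonomial_count.
by apply: fm; rewrite mdegree_count.
Qed.

End coupling_density.

Theorem theorem3p4 (R : realType) (n k : nat) (n_ge1 : (1 <= n)%N)
    (d1 d2 : measure_display) (T1 : measurableType d1) (T2 : measurableType d2)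
    (P1 : probability T1 R) (P2 : probability T2 R)
    (f1 : 'rV[R]_n -> {RV P1 >-> R}) (f2 : 'rV[R]_n -> {RV P2 >-> R})
    (rho1 rho2 : 'rV[R]_n -> R)
    (f1_csg : centered_stationary_gaussian f1)
    (f2_csg : centered_stationary_gaussian f2)
    (f1_rho : spectral_density f1 rho1)
    (f2_rho : spectral_density f2 rho2)
    (rho1_moments : finite_moments rho1 (2 * k.+1))
    (rho2_moments : finite_moments rho2 (2 * k.+1)) :
  exists (d : measure_display) (T : measurableType d) (P : probability T R)
      (g1 g2 : 'rV[R]_n -> {RV P >-> R}),
    let F : 'rV[R]_n -> {RV P >-> R} := fun x => g2 x \- g1 x in
    [/\ same_law g1 f1,
        same_law g2 f2,
        centered_stationary_gaussian F,
        forall a : 'I_n -> nat, (mdegree a <= k.+1)%N ->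
          mixed_partial_exists a (covariance_kernel F)
      & sup_derivative_variance F k.+1 =
          max_mdegree k.+1 (fun a => (derivative_variance F a 0)%:E) /\
        sup_derivative_variance F k.+1 =
          ereal_sup [set ((2 * pi) ^+ (2 * mdegree a))%:E *
              'N[lebesgue_rV n]_2%:E[(fun t =>
                 (monomial a t * (Num.sqrt (rho2 t) - Num.sqrt (rho1 t)))%:E)] ^+ 2
            | a in [set a : 'I_n -> nat | (mdegree a <= k.+1)%N]]%E].
Proof.
have [r1_ge0 r1N ir1 _] := f1_rho; have [r2_ge0 r2N ir2 _] := f2_rho.
have mr1 := rintegrable_measurable ir1; have mr2 := rintegrable_measurable ir2.
have se1 := sqint_weighted_cas r1_ge0 ir1; have se2 := sqint_weighted_cas r2_ge0 ir2.
have gf1 := density_spectral r1_ge0 r1N ir1 f1_csg f1_rho.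
have gf2 := density_spectral r2_ge0 r2N ir2 f2_csg f2_rho.
(* [f1] carries no noise on [A], where [g2] borrows it from the independent [f2]. *)
pose A : set 'rV[R]_n := [set t | rho1 t = 0].
have mA : measurable A.
  rewrite -[X in measurable X]setTI (_ : A = rho1 @^-1` [set 0])//.
  exact: mr1.
pose b1 t := if rho1 t == 0 then 0 else Num.sqrt (rho2 t).
pose b2 t := if rho1 t == 0 then Num.sqrt (rho2 t) else 0.
have mb1 : measurable_fun setT b1.
  rewrite (_ : b1 = fun t => \1_(~` A) t * Num.sqrt (rho2 t)).
    apply: measurable_funM; last exact: measurable_sqrt.
    by apply: measurable_indic; exact: measurableC.
  apply/funext => t; rewrite /b1 indicE; case: eqP => h.
    by rewrite memNset ?mul0r// => /(_ h).
  by rewrite mem_set ?mul1r.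
have mb2 : measurable_fun setT b2.
  rewrite (_ : b2 = fun t => \1_A t * Num.sqrt (rho2 t)).
    by apply: measurable_funM; [exact: measurable_indic|exact: measurable_sqrt].
  apply/funext => t; rewrite /b2 indicE; case: eqP => h.
    by rewrite mem_set ?mul1r.
  by rewrite memNset ?mul0r.
have bE t : b1 t ^+ 2 + b2 t ^+ 2 = rho2 t.
  by rewrite /b1 /b2; case: ifP; rewrite expr0n ?addr0 ?add0r sqr_sqrtr.
have sb (b : 'rV[R]_n -> R) x : measurable_fun setT b ->
    (forall t, `|b t| <= Num.sqrt (rho2 t)) -> sqint (lebesgue_rV n) (fun t => cas x t * b t).
  move=> mb bh; apply: sqint_le (se2 x).
    by apply: measurable_funM => //; exact: measurable_cas.
  by move=> t; rewrite !normrM ler_wpM2l// (le_trans (bh t))// ler_norm.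
have ext1 x : exists X, extends (lebesgue_rV n) P1 (weighted_cas rho1) f1
    (fun t => cas x t * b1 t) X.
  apply: (extends_exists se1 gf1); apply: in_closure_absolutely_continuous => //.
    apply: sb => // t; rewrite /b1; case: ifP => _; rewrite ?normr0 ?sqrtr_ge0//.
    by rewrite ger0_norm ?sqrtr_ge0.
  by move=> t rt; rewrite /b1 rt eqxx mulr0.
(* b2 vanishes wherever rho2 does, so the span attached to f2 contains what is needed on [A]. *)
have ext2 x : exists X, extends (lebesgue_rV n) P2 (weighted_cas rho2) f2
    (fun t => cas x t * b2 t) X.
  apply: (extends_exists se2 gf2); apply: in_closure_absolutely_continuous => //.
    apply: sb => // t; rewrite /b2; case: ifP => _; rewrite ?normr0 ?sqrtr_ge0//.
    by rewrite ger0_norm ?sqrtr_ge0.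
  by move=> t rt; rewrite /b2 rt sqrtr0 if_same mulr0.
have [X1 X1E] := choice ext1; have [X2 X2E] := choice ext2.
have mX1 x : measurable_fun setT (X1 x) by case: (X1E x) => _ [].
have mX2 x : measurable_fun setT (X2 x) by case: (X2E x) => _ [].
have mf1 x : measurable_fun setT (f1 x) by exact: measurable_funPT.
pose P : probability (T1 * T2)%type R := (P1 \x P2)%E.
have mg1 x : measurable_fun setT (fun w : T1 * T2 => f1 x w.1).
  exact: (measurableT_comp (mf1 x) measurable_fst).
have mg2 x : measurable_fun setT (fun w : T1 * T2 => X1 x w.1 + X2 x w.2).
  apply: measurable_funD; first exact: (measurableT_comp (mX1 x) measurable_fst).
  exact: (measurableT_comp (mX2 x) measurable_snd).
pose g1 x : {RV P >-> R} := HB.pack (fun w : T1 * T2 => f1 x w.1)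
  (@isMeasurableFun.Build _ _ _ _ _ (mg1 x)).
pose g2 x : {RV P >-> R} := HB.pack (fun w : T1 * T2 => X1 x w.1 + X2 x w.2)
  (@isMeasurableFun.Build _ _ _ _ _ (mg2 x)).
exists _, (T1 * T2)%type, P, g1, g2 => F.
(* g1 is fed by the first noise alone; its second amplitude is 0. *)
have ext0 x : extends (lebesgue_rV n) P2 (weighted_cas rho2) f2
    (fun t => cas x t * 0) (fun=> 0).
  rewrite -(comb_nil f2) (_ : (fun t => _) = comb [::] (weighted_cas rho2)).
    exact: extends_comb.
  by apply/funext => t; rewrite comb_nil mulr0.
have extf x : extends (lebesgue_rV n) P1 (weighted_cas rho1) f1
    (fun t => cas x t * Num.sqrt (rho1 t)) (f1 x).
  have E (S : Type) (e : 'rV[R]_n -> S -> R) : e x = comb [:: (1, x)] e.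
    by apply/funext => t; rewrite comb1 mul1r.
  rewrite -/(weighted_cas rho1 x) (E _ (weighted_cas rho1)) (E _ (fun x => f1 x)).
  exact: extends_comb.
have pair := spectral_field_pair se1 se2 gf1 gf2.
have sg1 : spectral_field rho1 P g1.
  have a12 t : Num.sqrt (rho1 t) ^+ 2 + 0 ^+ 2 = rho1 t.
    by rewrite expr0n addr0 sqr_sqrtr.
  have := pair _ _ _ _ _ r1_ge0 a12 extf ext0; congr (spectral_field _ _ _).
  by apply/funext => x; apply/funext => w; rewrite /= addr0.
have sg2 : spectral_field rho2 P g2 by exact: (pair _ _ _ _ _ r2_ge0 bE X1E X2E).
pose rho := coupling_density rho1 rho2.
have rho_ge0 t : 0 <= rho t by exact: sqr_ge0.
have rhoN t : rho (- t) = rho t by rewrite /rho /coupling_density r1N r2N.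
have irho s : (size s <= 2 * k.+1)%N ->
    rintegrable (lebesgue_rV n) (fun t => lmonomial s t * rho t).
  move=> sk; apply: rintegrable_coupling_density => //.
  - exact: measurable_lmonomial.
  - exact: rintegrable_lmonomial rho1_moments sk.
  - exact: rintegrable_lmonomial rho2_moments sk.
have irho0 : rintegrable (lebesgue_rV n) rho.
  have := irho [::] isT; under [X in rintegrable _ X -> _]eq_fun do
    rewrite /lmonomial big_nil mul1r.
  by [].
have sF : spectral_field rho P F.
  (* F is linear in the same noises: on the first factor X1 - f1 is the image of cas (b1 - sqrt
     rho1). *)
  have ext x := extends_lin se1 gf1 (-1) (extf x) (X1E x).
  rewrite (_ : (fun x => F x : T1 * T2 -> R) =
      fun x w => (-1 * f1 x w.1 + X1 x w.1) + X2 x w.2).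
    apply: (pair (fun t => b1 t - Num.sqrt (rho1 t)) b2 rho
      (fun x w => -1 * f1 x w + X1 x w) X2) => //.
      (* On [A] the first amplitude is 0 and sqrt rho1 = 0; off [A] the second amplitude is 0. *)
      move=> t; rewrite /rho /coupling_density /b1 /b2; case: eqP => [->|_].
        by rewrite sqrtr0 !subr0 expr0n add0r.
      by rewrite expr0n addr0.
    move=> x; have := ext x; congr (extends _ _ _ _ _ _); apply/funext => t.
    by rewrite mulrBr mulN1r addrC.
  by apply/funext => x; apply/funext => w; rewrite /F /=; ring.
have KE := spectral_covariance_kernel rho_ge0 rhoN irho0 sF.
have var a x : (mdegree a <= k.+1)%N -> derivative_variance F a x =
    (2 * pi) ^+ (2 * mdegree a) * \int[lebesgue_rV n]_t (monomial a t ^+ 2 * rho t).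
  by move=> ak; exact: (stationary_mixed_partial irho KE ak).
have supE : sup_derivative_variance F k.+1 =
    max_mdegree k.+1 (fun a => (derivative_variance F a 0)%:E).
  rewrite /sup_derivative_variance -[RHS]ereal_sup1; congr ereal_sup.
  have cst x : max_mdegree k.+1 (fun a => (derivative_variance F a x)%:E) =
      max_mdegree k.+1 (fun a => (derivative_variance F a 0)%:E).
    by apply: eq_max_mdegree => a ak; rewrite !var.
  by apply/seteqP; split => [_ [x _ <-]|_ ->] /=; [exact: cst|exists 0].
split.
- exact: spectral_same_law sg1 gf1.
- exact: spectral_same_law sg2 gf2.
- exact: (spectral_gaussian rho_ge0 rhoN irho0 sF).
- by move=> a ak; exact: (stationary_mixed_partial_exists irho KE ak).
split => //; rewrite supE (eq_max_mdegree (W := fun a => (((2 * pi) ^+ (2 * mdegree a))%:E *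
  'N[lebesgue_rV n]_2%:E[(fun t => (monomial a t *
    (Num.sqrt (rho2 t) - Num.sqrt (rho1 t)))%:E)] ^+ 2)%E)).
  exact: max_mdegree_ereal_sup.
move=> a ak; rewrite var// EFinM; congr (_ * _)%E.
have sq : (fun t => (monomial a t * (Num.sqrt (rho2 t) - Num.sqrt (rho1 t))) ^+ 2) =
    (fun t => monomial a t ^+ 2 * rho t) by apply/funext => t; rewrite exprMn.
rewrite Lnorm2_sqr sq//.
have := irho (directions a ++ directions a).
rewrite size_cat size_directions addnn -mul2n leq_mul2l ak orbT => /(_ isT).
congr (rintegrable _ _); apply/funext => t.
by rewrite -lmonomial_directions /lmonomial big_cat expr2.
Qed.
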